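(* Under assumptions (A1), (A2) and (A3) of the context, assume that $X$, $Y$ are compact sets, $\gamma_1>0$, $\gamma_2>0$, $c_k=c(k+1)^\rho$ with $c>0$, $\rho\in[0,1/2)$, and $\eta_k\in\big(\underline{\eta},\,1/(L_f+rL_{g_2}+1/\gamma_1)\big)$ with $\underline{\eta}>0$. Then there exists $c_\alpha>0$ such that when $\alpha_k\in(\underline{\alpha},c_\alpha)$ with $\underline{\alpha}>0$, the sequence $(x^k,y^k,z^k,\theta^k,\lambda^k)$ generated by the algorithm BiC-GAFFA satisfies $$\min_{0\le k\le K}R_k(x^{k+1},y^{k+1},z^{k+1})=O\Big(\frac{1}{K^{(1-2\rho)/2}}\Big).$$ Furthermore, if $\rho>0$ and $\psi_{c_k}(x^k,y^k,z^k)$ is uniformly bounded above, then the sequence $(x^k,y^k,z^k)$ satisfies $$0\le\mathcal{G}_\gamma(x^K,y^K,z^K)=O\Big(\frac{1}{K^{\rho}}\Big).$$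
   Context: $X\subseteq\mathbb{R}^n$ and $Y\subseteq\mathbb{R}^m$ are closed convex sets, $Z:=[0,r]^p$ with $r\ge0$; $F,f:X\times Y\to\mathbb{R}$ and $g:X\times Y\to\mathbb{R}^p$ are continuously differentiable. (A1) $F$ is $L_F$-smooth on $X\times Y$ (i.e. $\nabla F$ is $L_F$-Lipschitz there) and $\underline{F}:=\inf_{(x,y)\in X\times Y}F(x,y)>-\infty$. (A2) For each $x\in X$, $f$ is convex with respect to $y$ on $Y$; $f$ is continuously differentiable on an open set containing $X\times Y$ and is $L_f$-smooth on $X\times Y$. (A3) For each $x\in X$, $g$ is convex (componentwise) with respect to $y$ on $Y$; $g$ is $L_g$-Lipschitz continuous on $X\times Y$; $g$ is continuously differentiable on an open set containing $X\times Y$, and $\nabla_x g$ and $\nabla_y g$ are $L_{g_1}$- and $L_{g_2}$-Lipschitz continuous on $X\times Y$, respectively. Gap function: with $\mathcal{L}(x,y,z)=f(x,y)+z^{T}g(x,y)$ and $\gamma=(\gamma_1,\gamma_2)$, $$\mathcal{G}_{\gamma}(x,y,z):=\max_{\theta\in Y,\,\lambda\in\mathbb{R}^p_+}\Big\{\mathcal{L}(x,y,\lambda)-\tfrac{1}{2\gamma_2}\|\lambda-z\|^2-\mathcal{L}(x,\theta,z)-\tfrac{1}{2\gamma_1}\|\theta-y\|^2\Big\}.$$ It is continuously differentiable on $X\times Y\times\mathbb{R}^p_+$, with gradient components $\nabla_x\mathcal{G}_\gamma=\nabla_x f(x,y)+(\lambda^* )^{T}\nabla_x g(x,y)-\nabla_x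 f(x,\theta^* )-z^{T}\nabla_x g(x,\theta^* )$, $\nabla_y\mathcal{G}_\gamma=\nabla_y f(x,y)+(\lambda^* )^{T}\nabla_y g(x,y)-(y-\theta^* )/\gamma_1$, $\nabla_z\mathcal{G}_\gamma=-(z-\lambda^* )/\gamma_2-g(x,\theta^* )$, where $\theta^*=\operatorname{argmin}_{\theta\in Y}\{f(x,\theta)+z^{T}g(x,\theta)+\frac{1}{2\gamma_1}\|\theta-y\|^2\}$ and $\lambda^*=\mathrm{Proj}_{\mathbb{R}^p_+}(z+\gamma_2 g(x,y))$. Let $\psi_{c_k}(x,y,z):=F(x,y)+c_k\,\mathcal{G}_\gamma(x,y,z)$ and $$R_k(x,y,z):=\mathrm{dist}\big(0,\nabla\psi_{c_k}(x,y,z)+\mathcal{N}_{X\times Y\times Z}(x,y,z)\big),$$ with $\mathcal{N}$ the normal cone. Algorithm BiC-GAFFA: start from $(x^0,y^0,z^0)\in X\times Y\times Z$, $\theta^0\in Y$, with stepsizes $\alpha_k,\eta_k>0$ and penalty parameters $c_k$. For $k=0,1,2,\dots$: $d_\theta^k=\nabla_y f(x^k,\theta^k)+(z^k)^{T}\nabla_y g(x^k,\theta^k)+\frac1{\gamma_1}(\theta^k-y^k)$; $\theta^{k+1}=\mathrm{Proj}_Y(\theta^k-\eta_k d_\theta^k)$, $\lambda^{k+1}=\mathrm{Proj}_{\mathbb{R}^p_+}(z^k+\gamma_2 g(x^k,y^k))$; $d_x^k=\frac1{c_k}\nabla_xF(x^k,y^k)+\nabla_xf(x^k,y^k)+(\lambda^{k+1})^{T}\nabla_xg(x^k,y^k)-\nabla_xf(x^k,\theta^{k+1})-(z^k)^{T}\nabla_xg(x^k,\theta^{k+1})$;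 $d_y^k=\frac1{c_k}\nabla_yF(x^k,y^k)+\nabla_yf(x^k,y^k)+(\lambda^{k+1})^{T}\nabla_yg(x^k,y^k)-(y^k-\theta^{k+1})/\gamma_1$; $d_z^k=-(z^k-\lambda^{k+1})/\gamma_2-g(x^k,\theta^{k+1})$; $(x^{k+1},y^{k+1},z^{k+1})=\mathrm{Proj}_{X\times Y\times Z}\big((x^k,y^k,z^k)-\alpha_k(d_x^k,d_y^k,d_z^k)\big)$.
   Formalization: The Lipschitz constants of the Jacobians of g (in particular L_{g2}) are taken in the operator norm of z -> z^T A from sup norm to Euclidean norm; with the spectral or Frobenius norm the stepsize bound on eta_k is too large when p>1 and the claim fails in general. *)

(* Defs.v *)
From HB Require Import structures.
From mathcomp Require Export all_boot all_order all_algebra.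
From mathcomp Require Export all_classical all_reals all_analysis.
Import Order.TTheory GRing.Theory Num.Theory.
Import numFieldNormedType.Exports.

Set Implicit Arguments.
Unset Strict Implicit.
Unset Printing Implicit Defensive.

Local Open Scope classical_set_scope.
Local Open Scope ring_scope.

(* Points of R^n are row vectors, and R^n x R^m is identified with R^(n + m)
   through row_mx.  The library norm `|_| on 'rV[R]_n is the sup norm; it
   provides the topology only, and every metric notion below is stated with
   the Euclidean norm enorm. *)

Section Euclidean.
Variable R : realType.

Definition dot n (u v : 'rV[R]_n) : R := \sum_i u 0 i * v 0 i.

Definition enorm n (u : 'rV[R]_n) : R := Num.sqrt (dot u u).

(* The norm of a Jacobian A : 'M_(p, n) is that of the map z |-> z^T A from
   (R^p, sup norm) to (R^n, Euclidean norm).  With this norm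
   enorm (z *m A) <= r * mnorm A for every z in [0, r]^p, which is what the
   upper bound 1 / (L_f + r L_g2 + 1 / gamma_1) on the stepsizes relies on;
   the spectral norm would only give the factor r * sqrt p. *)
Definition mnorm p n (A : 'M[R]_(p, n)) : R :=
  sup [set enorm (z *m A) | z in [set z : 'rV[R]_p | forall i, `|z 0 i| <= 1]].

Definition setprod_row n m (A : set 'rV[R]_n) (B : set 'rV[R]_m) :
    set 'rV[R]_(n + m) :=
  [set w | A (lsubmx w) /\ B (rsubmx w)].

Definition box p (r : R) : set 'rV[R]_p := [set z | forall i, 0 <= z 0 i <= r].

Definition orthant p : set 'rV[R]_p := [set z | forall i, 0 <= z 0 i].

Definition is_proj n (C : set 'rV[R]_n) (u v : 'rV[R]_n) : Prop :=
  C v /\ forall w, C w -> enorm (u - v) <= enorm (u - w).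

Definition normal_cone n (C : set 'rV[R]_n) (w : 'rV[R]_n) : set 'rV[R]_n :=
  [set v | C w /\ forall w', C w' -> dot v (w' - w) <= 0].

Definition dist0 n (A : set 'rV[R]_n) : R := inf [set enorm v | v in A].

Definition grad n (h : 'rV[R]_n -> R) (w : 'rV[R]_n) : 'rV[R]_n :=
  \row_i 'D_(delta_mx 0 i) h w.

(* The library's 'J h w acts on row vectors, v |-> v *m 'J h w, and is thus the
   transpose of the usual Jacobian, whose rows are the gradients of the
   components of h. *)
Definition jac n p (h : 'rV[R]_n -> 'rV[R]_p) (w : 'rV[R]_n) : 'M[R]_(p, n) :=
  ('J h w)^T.

(* On a set D that is not open, differentiability at a point of D is
   differentiability in the ambient space; only the derivative is required to
   be continuous relatively to D. *)
Definition C1_on n (V : normedModType R) (D : set 'rV[R]_n)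
    (h : 'rV[R]_n -> V) : Prop :=
  (forall w, D w -> differentiable h w) /\
  (forall v, {within D, continuous (fun w => 'D_v h w)}).

Definition C1_around n (V : normedModType R) (D : set 'rV[R]_n)
    (h : 'rV[R]_n -> V) : Prop :=
  exists U, [/\ open U, D `<=` U & C1_on U h].

Definition lipschitz_vec n q (D : set 'rV[R]_n) (L : R)
    (h : 'rV[R]_n -> 'rV[R]_q) : Prop :=
  forall w w', D w -> D w' -> enorm (h w - h w') <= L * enorm (w - w').

Definition lipschitz_mx n q s (D : set 'rV[R]_n) (L : R)
    (h : 'rV[R]_n -> 'M[R]_(q, s)) : Prop :=
  forall w w', D w -> D w' -> mnorm (h w - h w') <= L * enorm (w - w').

Definition smooth_on n (D : set 'rV[R]_n) (L : R) (h : 'rV[R]_n -> R) : Prop :=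
  lipschitz_vec D L (grad h).

End Euclidean.

Arguments box {R} p r.
Arguments orthant {R} p.

Section Bilevel.
Variables (R : realType) (n m p : nat).
Variables (X : set 'rV[R]_n) (Y : set 'rV[R]_m) (r : R).
Variables (F f : 'rV[R]_(n + m) -> R) (g : 'rV[R]_(n + m) -> 'rV[R]_p).

Definition grad_x (h : 'rV[R]_(n + m) -> R) x y : 'rV[R]_n :=
  lsubmx (grad h (row_mx x y)).

Definition grad_y (h : 'rV[R]_(n + m) -> R) x y : 'rV[R]_m :=
  rsubmx (grad h (row_mx x y)).

Definition jac_x x y : 'M[R]_(p, n) := lsubmx (jac g (row_mx x y)).

Definition jac_y x y : 'M[R]_(p, m) := rsubmx (jac g (row_mx x y)).

Definition assumptionA1 (LF : R) : Prop :=
  [/\ 0 <= LF,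
      C1_on (setprod_row X Y) F,
      smooth_on (setprod_row X Y) LF F
    & has_lbound (F @` setprod_row X Y)].

Definition assumptionA2 (Lf : R) : Prop :=
  [/\ 0 <= Lf,
      forall x, X x -> convex_function Y (fun y => f (row_mx x y)),
      C1_around (setprod_row X Y) f
    & smooth_on (setprod_row X Y) Lf f].

Definition assumptionA3 (Lg Lg1 Lg2 : R) : Prop :=
  [/\ [/\ 0 <= Lg, 0 <= Lg1 & 0 <= Lg2],
      forall x, X x ->
        forall i, convex_function Y (fun y => g (row_mx x y) 0 i),
      lipschitz_vec (setprod_row X Y) Lg g,
      C1_around (setprod_row X Y) g
    & lipschitz_mx (setprod_row X Y) Lg1 (fun w => jac_x (lsubmx w) (rsubmx w))
      /\
      lipschitz_mx (setprod_row X Y) Lg2 (fun w => jac_y (lsubmx w) (rsubmx w))].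

Definition lagrangian x y z : R :=
  f (row_mx x y) + dot z (g (row_mx x y)).

Variables gamma1 gamma2 : R.

Definition gap x y z : R :=
  sup [set v | exists theta lambda, [/\ Y theta, orthant p lambda &
    v = lagrangian x y lambda - (2 * gamma2)^-1 * enorm (lambda - z) ^+ 2
        - lagrangian x theta z - (2 * gamma1)^-1 * enorm (theta - y) ^+ 2]].

Definition psi (c : R) x y z : R := F (row_mx x y) + c * gap x y z.

Definition row3 (x : 'rV[R]_n) (y : 'rV[R]_m) (z : 'rV[R]_p) :
    'rV[R]_(n + m + p) :=
  row_mx (row_mx x y) z.

Definition XYZ : set 'rV[R]_(n + m + p) :=
  setprod_row (setprod_row X Y) (box p r).

Definition grad_psi (c : R) (w : 'rV[R]_(n + m + p)) : 'rV[R]_(n + m + p) :=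
  grad (fun w => psi c (lsubmx (lsubmx w)) (rsubmx (lsubmx w)) (rsubmx w)) w.

Definition residual (c : R) x y z : R :=
  dist0 [set grad_psi c (row3 x y z) + v
        | v in normal_cone XYZ (row3 x y z)].

Variables (c eta alpha : nat -> R).

Definition dir_theta x y z theta : 'rV[R]_m :=
  grad_y f x theta + z *m jac_y x theta + gamma1^-1 *: (theta - y).

Definition dir_x (ck : R) x y z theta lambda : 'rV[R]_n :=
  ck^-1 *: grad_x F x y + grad_x f x y + lambda *m jac_x x y
  - grad_x f x theta - z *m jac_x x theta.

Definition dir_y (ck : R) x y theta lambda : 'rV[R]_m :=
  ck^-1 *: grad_y F x y + grad_y f x y + lambda *m jac_y x y
  - gamma1^-1 *: (y - theta).

Definition dir_z x z theta lambda : 'rV[R]_p :=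
  - (gamma2^-1 *: (z - lambda)) - g (row_mx x theta).

(* lambda 0 is never used by the algorithm and is left unconstrained. *)
Record BiC_GAFFA (x : nat -> 'rV[R]_n) (y : nat -> 'rV[R]_m)
    (z : nat -> 'rV[R]_p) (theta : nat -> 'rV[R]_m)
    (lambda : nat -> 'rV[R]_p) : Prop := {
  gaffa_init : [/\ X (x 0%N), Y (y 0%N), box p r (z 0%N) & Y (theta 0%N)];
  gaffa_theta : forall k, is_proj Y
    (theta k - eta k *: dir_theta (x k) (y k) (z k) (theta k)) (theta k.+1);
  gaffa_lambda : forall k, is_proj (orthant p)
    (z k + gamma2 *: g (row_mx (x k) (y k))) (lambda k.+1);
  gaffa_xyz : forall k, is_proj XYZ
    (row3 (x k) (y k) (z k) - alpha k *:
       row3 (dir_x (c k) (x k) (y k) (z k) (theta k.+1) (lambda k.+1))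
            (dir_y (c k) (x k) (y k) (theta k.+1) (lambda k.+1))
            (dir_z (x k) (z k) (theta k.+1) (lambda k.+1)))
    (row3 (x k.+1) (y k.+1) (z k.+1)) }.

End Bilevel.

(* Main.v *)
Require Import Defs.
From mathcomp Require Import ring lra.
Import Order.TTheory GRing.Theory Num.Theory.
Import numFieldNormedType.Exports.
Set Implicit Arguments.
Unset Strict Implicit.
Unset Printing Implicit Defensive.
Local Open Scope classical_set_scope.
Local Open Scope ring_scope.

(** The gap function splits as [gap = A - B], where [A] is the maximum over
    [lambda], which has a closed form, and [B (x, y, z)] is the minimum over [Y]
    of a [1 / gamma1]-strongly convex function of [theta].  Danskin's theorem
    gives the gradient of [B] at every point of [X * Y * Z], including in the
    directions that leave this set, and this gradient is Lipschitz because the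
    minimizer [theta_star] is.

    With [w_k = (x_k, y_k, z_k)], [phi_k = F / c_k + gap],
    [D_k = |w_(k+1) - w_k|] and [e_k = |theta_k - theta_star w_k|], the
    projected gradient step on [theta] contracts towards [theta_star w_k], and
    the step on [w] uses the gradient of [phi_k] up to an error [O(e_k)].  Hence
    [V_k = phi_k w_k - inf F / c_k + C e_k^2] satisfies
    [V_(k+1) + D_k^2 + e_k^2 <= V_k] for small [alpha], so that
    [D_k^2 + e_k^2] is summable.  Optimality of the projection bounds the
    residual by [C c_k (D_k + e_k)], and [c_k = c0 (k + 1)^rho] gives the rate
    of the minimal residual.  The bound on the gap is [c_k gap <= M - inf F]. *)

(** * Euclidean geometry *)

(** Dividing [psi] by [c_k] is what allows one [c_alpha] for all [k]: the Lipschitz bound for the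
    gradient of [F / c_k + gap] is uniform over [c_k >= c0], while the one for [psi] grows with
    [c_k]. Since the penalty changes at each step, the descent must survive the passage from [c_k]
    to [c_(k+1)]; subtracting [inf F / c_k] leaves [F - inf F >= 0] multiplied by the nonincreasing
    [1 / c_k], so this passage can only help. The target [theta_star w_k] moves with [w_k], by
    [O(D_k)]. The contraction of [e_k] absorbs this drift once [D_k^2] carries a large weight, that
    is, once [1 / alpha_k] is large; this is the origin of [c_alpha]. The two halves of the gap need
    different treatment. Danskin's theorem relies on compactness and covers the minimum over [Y];
    the orthant is not compact, so the maximum over [lambda] is differentiated through its closed
    form. Finally [rho < 1/2] enters because the squared residual carries [c_K^2], of order
    [K^(2 rho)], against an average over [K + 1] summable terms. *)

Section Dot.
Variable R : realType.
Implicit Types n m p q : nat.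

Lemma dotC n (u v : 'rV[R]_n) : dot u v = dot v u.
Proof. by apply: eq_bigr => i _; rewrite mulrC. Qed.

Lemma dotDl n (u v w : 'rV[R]_n) : dot (u + v) w = dot u w + dot v w.
Proof. by rewrite -big_split; apply: eq_bigr => i _; rewrite mxE mulrDl. Qed.

Lemma dotDr n (u v w : 'rV[R]_n) : dot w (u + v) = dot w u + dot w v.
Proof. by rewrite dotC dotDl !(dotC w). Qed.

Lemma dotZl n (a : R) (u v : 'rV[R]_n) : dot (a *: u) v = a * dot u v.
Proof. by rewrite mulr_sumr; apply: eq_bigr => i _; rewrite mxE mulrA. Qed.

Lemma dotZr n (a : R) (u v : 'rV[R]_n) : dot u (a *: v) = a * dot u v.
Proof. by rewrite dotC dotZl dotC. Qed.

Lemma dotNl n (u v : 'rV[R]_n) : dot (- u) v = - dot u v.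
Proof. by rewrite -scaleN1r dotZl mulN1r. Qed.

Lemma dotNr n (u v : 'rV[R]_n) : dot u (- v) = - dot u v.
Proof. by rewrite dotC dotNl dotC. Qed.

Lemma dotBl n (u v w : 'rV[R]_n) : dot (u - v) w = dot u w - dot v w.
Proof. by rewrite dotDl dotNl. Qed.

Lemma dotBr n (u v w : 'rV[R]_n) : dot w (u - v) = dot w u - dot w v.
Proof. by rewrite dotDr dotNr. Qed.

Lemma dot0l n (u : 'rV[R]_n) : dot 0 u = 0.
Proof. by rewrite -(scale0r u) dotZl mul0r. Qed.

Lemma dot0r n (u : 'rV[R]_n) : dot u 0 = 0.
Proof. by rewrite dotC dot0l. Qed.

Lemma dot_ge0 n (u : 'rV[R]_n) : 0 <= dot u u.
Proof. by apply: sumr_ge0 => i _; rewrite -expr2 sqr_ge0. Qed.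

Lemma dot_delta n (u : 'rV[R]_n) i : dot u (delta_mx 0 i) = u 0 i.
Proof.
rewrite /dot (bigD1 i)//= big1 ?addr0 => [|j ji].
  by rewrite mxE !eqxx mulr1.
by rewrite mxE (negPf ji) andbF mulr0.
Qed.

Lemma enorm_ge0 n (u : 'rV[R]_n) : 0 <= enorm u.
Proof. exact: sqrtr_ge0. Qed.

Lemma enorm_sqr n (u : 'rV[R]_n) : enorm u ^+ 2 = dot u u.
Proof. by rewrite sqr_sqrtr// dot_ge0. Qed.

Lemma enorm_le n m (u : 'rV[R]_n) (v : 'rV[R]_m) :
  dot u u <= dot v v -> enorm u <= enorm v.
Proof. exact: ler_wsqrtr. Qed.

Lemma enorm0_eq0 n (u : 'rV[R]_n) : enorm u = 0 -> u = 0.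
Proof.
move=> u0; have : dot u u = 0 by rewrite -enorm_sqr u0 expr0n.
move/eqP; rewrite psumr_eq0 => [|i _]; last by rewrite -expr2 sqr_ge0.
move=> /allP ui; apply/rowP => i; rewrite mxE.
by have := ui i (mem_index_enum i); rewrite -expr2 sqrf_eq0 => /eqP.
Qed.

Lemma enorm0 n : enorm (0 : 'rV[R]_n) = 0.
Proof. by rewrite /enorm dot0l sqrtr0. Qed.

Lemma enormZ n (a : R) (u : 'rV[R]_n) : enorm (a *: u) = `|a| * enorm u.
Proof.
by rewrite /enorm dotZl dotZr mulrA -expr2 sqrtrM ?sqr_ge0// sqrtr_sqr.
Qed.

Lemma enormN n (u : 'rV[R]_n) : enorm (- u) = enorm u.
Proof. by rewrite -scaleN1r enormZ normrN1 mul1r. Qed.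

Lemma enormB n (u v : 'rV[R]_n) : enorm (u - v) = enorm (v - u).
Proof. by rewrite -enormN opprB. Qed.

Lemma cauchy_schwarz n (u v : 'rV[R]_n) : dot u v <= enorm u * enorm v.
Proof.
have [u0|un0] := eqVneq (enorm u) 0.
  by rewrite (enorm0_eq0 u0) dot0l enorm0 mul0r.
have [v0|vn0] := eqVneq (enorm v) 0.
  by rewrite (enorm0_eq0 v0) dot0r enorm0 mulr0.
have u0 : 0 < enorm u by rewrite lt_def un0 enorm_ge0.
have v0 : 0 < enorm v by rewrite lt_def vn0 enorm_ge0.
have := dot_ge0 (enorm v *: u - enorm u *: v).
rewrite dotBl !dotBr !dotZl !dotZr (dotC v u) -!enorm_sqr => h.
rewrite -subr_ge0 -(pmulr_rge0 _ (mulr_gt0 u0 v0)).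
move: h; set a := enorm u; set b := enorm v; nra.
Qed.

Lemma enormD n (u v : 'rV[R]_n) : enorm (u + v) <= enorm u + enorm v.
Proof.
rewrite -(@ler_pXn2r _ 2)// ?nnegrE ?addr_ge0 ?enorm_ge0//.
rewrite enorm_sqr dotDl !dotDr (dotC v u) sqrrD -!enorm_sqr.
have := cauchy_schwarz u v; lra.
Qed.

Lemma enormBD n (w u v : 'rV[R]_n) :
  enorm (u - v) <= enorm (u - w) + enorm (w - v).
Proof. by rewrite -[u - v](subrKA w) enormD. Qed.

Lemma dot_row n m (a a' : 'rV[R]_n) (b b' : 'rV[R]_m) :
  dot (row_mx a b) (row_mx a' b') = dot a a' + dot b b'.
Proof.
rewrite /dot big_split_ord /=; congr (_ + _).
  by apply: eq_bigr => i _; rewrite !row_mxEl.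
by apply: eq_bigr => i _; rewrite !row_mxEr.
Qed.

Lemma dot_lr n m (u v : 'rV[R]_(n + m)) :
  dot u v = dot (lsubmx u) (lsubmx v) + dot (rsubmx u) (rsubmx v).
Proof. by rewrite -{1}(hsubmxK u) -{1}(hsubmxK v) dot_row. Qed.

Lemma enorm_lsub n m (u : 'rV[R]_(n + m)) : enorm (lsubmx u) <= enorm u.
Proof. by apply: enorm_le; rewrite (dot_lr u) lerDl dot_ge0. Qed.

Lemma enorm_rsub n m (u : 'rV[R]_(n + m)) : enorm (rsubmx u) <= enorm u.
Proof. by apply: enorm_le; rewrite (dot_lr u) lerDr dot_ge0. Qed.

Lemma enorm_row0l n m (b : 'rV[R]_m) : enorm (row_mx (0 : 'rV[R]_n) b) = enorm b.
Proof. by rewrite /enorm dot_row dot0l add0r. Qed.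

Lemma enorm_row0r n m (a : 'rV[R]_n) : enorm (row_mx a (0 : 'rV[R]_m)) = enorm a.
Proof. by rewrite /enorm dot_row dot0l addr0. Qed.

Lemma enorm_row n m (a : 'rV[R]_n) (b : 'rV[R]_m) :
  enorm (row_mx a b) <= enorm a + enorm b.
Proof.
rewrite -(enorm_row0r m a) -(enorm_row0l n b) (le_trans _ (enormD _ _))//.
by rewrite add_row_mx addr0 add0r.
Qed.

Lemma row_mxB n m (a a' : 'rV[R]_n) (b b' : 'rV[R]_m) :
  row_mx a b - row_mx a' b' = row_mx (a - a') (b - b').
Proof. by rewrite opp_row_mx add_row_mx. Qed.

Lemma enorm_row3_bounds n m p (x x' : 'rV[R]_n) (y y' : 'rV[R]_m)
    (z z' : 'rV[R]_p) (N := enorm (row3 x y z - row3 x' y' z')) :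
  [/\ enorm (row_mx x y - row_mx x' y') <= N, enorm (x - x') <= N,
      enorm (y - y') <= N & enorm (z - z') <= N].
Proof.
rewrite /N /row3 !row_mxB.
have h1 := enorm_lsub (row_mx (x - x') (y - y')).
have h2 := enorm_rsub (row_mx (x - x') (y - y')).
have h3 := enorm_lsub (row_mx (row_mx (x - x') (y - y')) (z - z')).
have h4 := enorm_rsub (row_mx (row_mx (x - x') (y - y')) (z - z')).
rewrite !(row_mxKl, row_mxKr) in h1 h2 h3 h4.
by split => //; exact: le_trans h3.
Qed.

Lemma abs_le_enorm n (u : 'rV[R]_n) i : `|u 0 i| <= enorm u.
Proof.
rewrite -sqrtr_sqr; apply: ler_wsqrtr.
by rewrite /dot (bigD1 i)//= -expr2 lerDl sumr_ge0// => j _; rewrite -expr2 sqr_ge0.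
Qed.

Lemma enorm_le_sum n (u : 'rV[R]_n) : enorm u <= \sum_i `|u 0 i|.
Proof.
have s0 : 0 <= \sum_i `|u 0 i| by apply: sumr_ge0.
rewrite -(@ler_pXn2r _ 2)// ?nnegrE ?enorm_ge0// enorm_sqr expr2 mulr_suml.
apply: ler_sum => i _; rewrite (le_trans (ler_norm _))// normrM ler_wpM2l//.
by rewrite (bigD1 i)//= lerDl sumr_ge0.
Qed.

(** This keeps the supremum in [mnorm] from being a default value. *)
Lemma mnorm_has_ubound p n (A : 'M[R]_(p, n)) :
  has_ubound [set enorm (z *m A) | z in
    [set z : 'rV[R]_p | forall i, `|z 0 i| <= 1]].
Proof.
exists (\sum_j \sum_i `|A i j|) => _ [z /= z1 <-].
rewrite (le_trans (enorm_le_sum _))//; apply: ler_sum => j _.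
rewrite mxE (le_trans (ler_norm_sum _ _ _))//; apply: ler_sum => i _.
by rewrite normrM -[leRHS]mul1r ler_wpM2r.
Qed.

Lemma mnorm_ge0 p n (A : 'M[R]_(p, n)) : 0 <= mnorm A.
Proof.
apply: (ub_le_sup (mnorm_has_ubound A)); exists 0; last by rewrite mul0mx enorm0.
by move=> i; rewrite mxE normr0.
Qed.

(** Rescale [z] by [1 / B]. The case [B = 0] is separate and does occur, since [r = 0] is allowed;
    it forces [z = 0]. *)
Lemma enorm_mulmx p n (B : R) (z : 'rV[R]_p) (A : 'M[R]_(p, n)) :
  0 <= B -> (forall i, `|z 0 i| <= B) -> enorm (z *m A) <= B * mnorm A.
Proof.
rewrite le_eqVlt => /predU1P[<-|B0] zB.
  rewrite (_ : z = 0) ?mul0mx ?enorm0 ?mul0r//; apply/rowP => i.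
  by rewrite mxE; apply/normr0_eq0/eqP; rewrite eq_le zB normr_ge0.
rewrite -ler_pdivrMl//; apply: (ub_le_sup (mnorm_has_ubound A)).
exists (B^-1 *: z) => [i|].
  by rewrite mxE normrM gtr0_norm ?invr_gt0// ler_pdivrMl// mulr1.
by rewrite -scalemxAl enormZ gtr0_norm ?invr_gt0.
Qed.

(** Stands for letting [t] tend to 0 in first-order arguments. If [a > 0], then [t = 1] forces
    [b > 0], and [t = a / (2 (a + b))] gives [t b < a]. *)
Lemma le_vanishing (a b : R) :
  (forall t, 0 < t <= 1 -> a <= t * b) -> a <= 0.
Proof.
move=> h; rewrite leNgt; apply/negP => a0.
have b0 : 0 < b by have := h 1; rewrite ltr01 lexx mul1r => /(_ isT); lra.
have t0 : 0 < a / (2 * (a + b)) by rewrite divr_gt0//; nra.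
have t1 : a / (2 * (a + b)) <= 1 by rewrite ler_pdivrMr; nra.
have := h (a / (2 * (a + b))); rewrite t0 t1 => /(_ isT).
rewrite -mulrA (mulrC _ b) mulrA ler_pdivlMr; nra.
Qed.

(** Written with a base point and a direction, the form in which functions are differentiated along
    segments. *)
Definition cvx n (C : set 'rV[R]_n) := forall u v (t : R),
  C u -> C v -> 0 <= t <= 1 -> C (u + t *: (v - u)).

Lemma convex_set_cvx n (C : set 'rV[R]_n) : convex_set C -> cvx C.
Proof.
move=> cC u v t Cu Cv /andP[t0 t1].
have := cC v u (Itv01 t0 t1); rewrite !inE => /(_ Cv Cu).
rewrite /conv/=; congr C.
by rewrite scalerBr scalerBl scale1r addrCA addrC -!addrA.
Qed.

(** Compare [v] with [v + t (w - v)], divide by [t] and let [t] vanish. *)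
Lemma proj_vi n (C : set 'rV[R]_n) (u v w : 'rV[R]_n) :
  cvx C -> is_proj C u v -> C w -> dot (u - v) (w - v) <= 0.
Proof.
move=> cC [Cv pv] Cw; apply: (@le_vanishing _ (dot (w - v) (w - v) / 2)).
move=> t /andP[t0 t1]; have t01 : 0 <= t <= 1 by rewrite ltW.
have := pv _ (cC _ _ _ Cv Cw t01).
rewrite -(@ler_pXn2r _ 2)// ?nnegrE ?enorm_ge0// !enorm_sqr opprD addrA.
move: (u - v) (w - v) => a b {pv}.
rewrite [leRHS]dotBl !dotBr !dotZl !dotZr (dotC b a) => h.
have {h} : t * (2 * dot a b) <= t * (t * dot b b) by lra.
by rewrite ler_pM2l//; lra.
Qed.

(** Adding the two variational inequalities bounds [|v - v'|^2] by [dot (u - u') (v - v')];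
    Cauchy-Schwarz concludes. *)
Lemma proj_nonexpansive n (C : set 'rV[R]_n) (u v u' v' : 'rV[R]_n) :
  cvx C -> is_proj C u v -> is_proj C u' v' -> enorm (v - v') <= enorm (u - u').
Proof.
move=> cC pu pu'; have := proj_vi cC pu pu'.1; have := proj_vi cC pu' pu.1.
move=> h1 h2.
have e : enorm (v - v') ^+ 2 <= enorm (u - u') * enorm (v - v').
  apply: le_trans (cauchy_schwarz _ _); rewrite enorm_sqr.
  move: h1 h2; rewrite !dotBl !dotBr (dotC v' v); lra.
have [->|n0] := eqVneq (enorm (v - v')) 0; first exact: enorm_ge0.
by rewrite -(@ler_pM2r _ (enorm (v - v'))) -?expr2// lt_def n0 enorm_ge0.
Qed.

End Dot.

(** * Smooth functions on convex sets *)

Section Calculus.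
Variable R : realType.

(** Both difference quotients are the same function. The base point is [w + t v] for any [t], so
    that the mean value theorem can be used along a whole segment. *)
Lemma is_derive_line n (h : 'rV[R]_n -> R) (w v : 'rV[R]_n) (t l : R) :
  is_derive (w + t *: v) v h l <-> is_derive t 1 (fun s => h (w + s *: v)) l.
Proof.
have E : (fun s : R => s^-1 *: ((h \o shift (w + t *: v)) (s *: v) - h (w + t *: v)))
  = (fun s : R => s^-1 *: (((fun s => h (w + s *: v)) \o shift t) (s *: 1)
      - h (w + t *: v))).
  apply/funext => s /=; congr (_ *: (h _ - _)).
  by rewrite scalerDl [_ *: 1]mulr1 addrCA.
split=> -[d e]; split.
- by move: d; rewrite /derivable E.
- by move: e; rewrite /derive E.
- by rewrite /derivable E.
- by rewrite /derive E.
Qed.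

Lemma is_derive_mul (h k : R -> R) (t dh dk : R) :
  is_derive t 1 h dh -> is_derive t 1 k dk ->
  is_derive t 1 (fun s => h s * k s) (h t * dk + k t * dh).
Proof. by move=> hh hk; exact: (is_deriveM hh hk). Qed.

Lemma is_derive_scale (h : R -> R) (t c dh : R) :
  is_derive t 1 h dh -> is_derive t 1 (fun s => c * h s) (c * dh).
Proof. by move=> hh; exact: (is_deriveZ c hh). Qed.

Lemma is_derive_continuous (h : R -> R) (t l : R) :
  is_derive t 1 h l -> {for t, continuous h}.
Proof. by move=> [d _]; apply/differentiable_continuous/derivable1_diffP. Qed.

(** The endpoints come in either order because Danskin's theorem perturbs by [t] of both signs. *)
Lemma mvt_segment (h dh : R -> R) (a b : R) :
  (forall t, Num.min a b <= t <= Num.max a b -> is_derive t 1 h (dh t)) ->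
  exists2 t, Num.min a b <= t <= Num.max a b & h b - h a = dh t * (b - a).
Proof.
wlog ab : a b / a <= b => [wl|] hd.
  have /orP[ab|ba] := le_total a b; first exact: wl.
  have [|t t1 t2] := wl b a ba; first by rewrite minC maxC.
  by exists t; [rewrite minC maxC|rewrite -opprB t2 -mulrN opprB].
move: hd; rewrite (min_idPl ab) (max_idPr ab) => hd.
have [||t] := @MVT_segment R h dh a b ab.
- move=> t; rewrite in_itv/= => /andP[/ltW ta /ltW tb].
  by apply: hd; rewrite ta tb.
- apply: continuous_in_subspaceT => t; rewrite inE/= in_itv/= => tab.
  exact: is_derive_continuous (hd _ tab).
- by rewrite in_itv/= => tab ->; exists t.
Qed.

Section Smooth.
Variables (n : nat) (D : set 'rV[R]_n) (h : 'rV[R]_n -> R)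
  (q : 'rV[R]_n -> 'rV[R]_n) (L : R).
Hypothesis cD : cvx D.
Hypothesis hq : forall w v, D w -> is_derive w v h (dot (q w) v).
Hypothesis qL : lipschitz_vec D L q.

(** Integration-free: [phi] removes from [h], along the segment, its linear part and [c t^2] with
    [c = L / 2 |d|^2]. The Lipschitz bound makes [dphi] nonpositive, and the mean value theorem
    gives [phi 1 <= phi 0]. *)
Lemma descent w w' : D w -> D w' ->
  h w' <= h w + dot (q w) (w' - w) + L / 2 * enorm (w' - w) ^+ 2.
Proof.
move=> Dw Dw'; set d := w' - w.
pose c := L / 2 * enorm d ^+ 2.
pose phi (t : R) := h (w + t *: d) - dot (q w) d * t - c * (t * t).
pose dphi (t : R) := dot (q (w + t *: d)) d - dot (q w) d - c * (t + t).
have dphiE (t : R) : 0 <= t <= 1 -> is_derive t 1 phi (dphi t).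
  move=> t01; have Dt : D (w + t *: d) by exact: cD.
  have h1 : is_derive t 1 (fun s : R => h (w + s *: d)) (dot (q (w + t *: d)) d).
    by apply/is_derive_line; exact: hq.
  have h2 : is_derive t 1 (fun s : R => dot (q w) d * s) (dot (q w) d).
    by have := is_derive_scale (dot (q w) d) (is_derive_id t (1 : R)); rewrite mulr1.
  have h3 : is_derive t 1 (fun s : R => c * (s * s)) (c * (t + t)).
    have := is_derive_mul (is_derive_id t (1 : R)) (is_derive_id t (1 : R)).
    by move/(is_derive_scale c); rewrite !mulr1.
  exact: (is_deriveB (is_deriveB h1 h2) h3).
have [|t] := @mvt_segment phi dphi 0 1.
  by rewrite (min_idPl ler01) (max_idPr ler01); exact: dphiE.
rewrite (min_idPl ler01) (max_idPr ler01) => t01 e.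
suff: phi 1 - phi 0 <= 0.
  rewrite /phi scale0r scale1r addr0 /d subrKC -/d /c; lra.
rewrite e /dphi subr0 mulr1.
have /andP[t0 _] := t01.
have := cauchy_schwarz (q (w + t *: d) - q w) d; rewrite dotBl.
have := qL (cD Dw Dw' t01) Dw; rewrite [w + _ - w]addrC addKr enormZ (ger0_norm t0).
have := enorm_ge0 d; rewrite /c -/d; nra.
Qed.

End Smooth.

Section SmoothConvex.
Variables (n : nat) (D : set 'rV[R]_n) (h : 'rV[R]_n -> R)
  (q : 'rV[R]_n -> 'rV[R]_n) (L : R).
Hypothesis cD : cvx D.
Hypothesis hq : forall w v, D w -> is_derive w v h (dot (q w) v).
Hypothesis qL : lipschitz_vec D L q.

Lemma descent_lower w w' : D w -> D w' ->
  h w + dot (q w) (w' - w) - L / 2 * enorm (w' - w) ^+ 2 <= h w'.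
Proof.
move=> Dw Dw'.
have H := @descent _ D (fun u => - h u) (fun u => - q u) L cD.
have {H} : - h w' <= - h w + dot (- q w) (w' - w) + L / 2 * enorm (w' - w) ^+ 2.
  apply: H => // [u v Du|u u' Du Du'].
    by rewrite dotNl; apply: is_deriveN; exact: hq.
  by rewrite -opprD enormN; exact: qL.
rewrite dotNl; lra.
Qed.

(** Convexity bounds [h] at [w + t (w' - w)] from above and [descent_lower] bounds it from below.
    The mismatch is of order [t^2], so it vanishes after division by [t]. *)
Lemma convex_gradient_le w w' : D w -> D w' ->
  (forall t, 0 <= t <= 1 -> h (w + t *: (w' - w)) <= h w + t * (h w' - h w)) ->
  h w + dot (q w) (w' - w) <= h w'.
Proof.
move=> Dw Dw' hc; rewrite -subr_le0.
apply: (@le_vanishing _ _ (L / 2 * enorm (w' - w) ^+ 2)) => t /andP[t0 t1].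
have t01 : 0 <= t <= 1 by rewrite ltW.
have := descent_lower Dw (cD Dw Dw' t01); have := hc t t01.
rewrite [w + t *: _ - w]addrC addKr dotZr enormZ (gtr0_norm t0) exprMn => h1 h2.
rewrite -(ler_pM2l t0); nra.
Qed.

Lemma minimizer_vi w w' : D w -> D w' ->
  (forall u, D u -> h w <= h u) -> 0 <= dot (q w) (w' - w).
Proof.
move=> Dw Dw' hm; rewrite -oppr_le0.
apply: (@le_vanishing _ _ (L / 2 * enorm (w' - w) ^+ 2)) => t /andP[t0 t1].
have t01 : 0 <= t <= 1 by rewrite ltW.
have := descent cD hq qL Dw (cD Dw Dw' t01); have := hm _ (cD Dw Dw' t01).
rewrite [w + t *: _ - w]addrC addKr dotZr enormZ (gtr0_norm t0) exprMn => h1 h2.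
rewrite -(ler_pM2l t0); nra.
Qed.

End SmoothConvex.
End Calculus.

(** * Danskin's theorem *)

Section Danskin.
Variables (R : realType) (T : topologicalType).

(** Little-o form of the derivative. It suits functions known only through inequalities, such as an
    infimum or a positive part. *)
Lemma is_derive_expansion (b : R -> R) (x l : R) :
  (forall e, 0 < e ->
    \forall t \near (0 : R), `|b (t + x) - b x - t * l| <= e * `|t|) ->
  is_derive x (1 : R) b l.
Proof.
move=> hb.
have H : (fun s : R => s^-1 *: ((b \o shift x) (s *: (1 : R)) - b x)) @ 0^' --> l.
  apply/cvgrPdist_le => /= e e0; near=> s.
  have s0 : s != 0 by near: s; exact: nbhs_dnbhs_neq.
  rewrite [s *: 1]mulr1 [_ *: _]mulrC distrC.
  rewrite (_ : _ - l = (b (s + x) - b x - s * l) / s); last by field.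
  rewrite normrM normfV ler_pdivrMr ?normr_gt0//.
  by near: s; apply: nbhs_dnbhs; exact: hb.
by split; [apply/cvg_ex; exists l|apply: cvg_lim].
Unshelve. all: by end_near. Qed.

Lemma abs_le_between (s t : R) : Num.min 0 t <= s <= Num.max 0 t -> `|s| <= `|t|.
Proof.
have /orP[t0|t0] := le_total 0 t.
  by rewrite (min_idPl t0) (max_idPr t0) => /andP[s0 st]; rewrite !ger0_norm.
rewrite (min_idPr t0) (max_idPl t0) => /andP[s0 st]; rewrite !ler0_norm//; lra.
Qed.

(** The expansion in [t] is uniform in [u] near [theta]: for fixed [u] the mean value theorem gives
    [t * dH s u], and joint continuity brings [dH s u] close to [dH 0 theta]. *)
Lemma mvt_near (H dH : R -> T -> R) (theta : T) :
  (\forall t \near (0 : R) & u \near theta, is_derive t (1 : R) (H ^~ u) (dH t u)) ->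
  {for (0, theta), continuous (fun q : R * T => dH q.1 q.2)} ->
  forall e, 0 < e -> \forall t \near (0 : R) & u \near theta,
    `|H t u - H 0 u - t * dH 0 theta| <= e * `|t|.
Proof.
move=> hH cH e e0.
have : \forall q \near ((0 : R), theta), is_derive q.1 (1 : R) (H ^~ q.2) (dH q.1 q.2) /\
    `|dH 0 theta - dH q.1 q.2| <= e.
  apply: filterI; first exact: hH.
  by move/cvgrPdist_le : cH => /(_ e e0).
move=> [[A B] [/= A0 Bt] AB].
have [d /= d0 dA] := A0.
(* With [t], a ball around 0 contains everything between 0 and [t], hence the mean value point. *)
exists (ball (0 : R) d, B) => /=.
  by split => //; exact: nbhsx_ballx.
move=> [t u] /= [td Bu].
have ABs s : Num.min 0 t <= s <= Num.max 0 t ->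
    is_derive s (1 : R) (H ^~ u) (dH s u) /\ `|dH 0 theta - dH s u| <= e.
  move=> st; suff /AB : (A `*` B) (s, u) by [].
  split => //=; apply: dA; move: td; rewrite /ball/= !sub0r !normrN.
  exact: le_lt_trans (abs_le_between st).
have [|s st ->] := @mvt_segment R (H ^~ u) (dH ^~ u) 0 t.
  by move=> s /ABs[].
rewrite subr0 (mulrC t) -mulrBl normrM ler_wpM2r// distrC.
by have [] := ABs _ st.
Qed.

Section Infimum.
Variables (Y : set T) (H : R -> T -> R) (theta : T) (l : R).
Hypothesis cY : compact Y.
Hypothesis Yt : Y theta.
Hypothesis Hmin : forall u, Y u -> u <> theta -> H 0 theta < H 0 u.
Hypothesis Hc :
  forall u, Y u -> {for (0, u), continuous (fun q : R * T => H q.1 q.2)}.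
Hypothesis Hl : forall e, 0 < e -> \forall t \near (0 : R) & u \near theta,
  `|H t u - H 0 u - t * l| <= e * `|t|.

Let Hle u : Y u -> H 0 theta <= H 0 u.
Proof. by move=> Yu; have [->//|/eqP/(Hmin Yu)/ltW] := eqVneq u theta. Qed.

(* Near [theta] the bound is the uniform expansion [Hl], near any other point of
   [Y] it is the strict minimality of [theta]; compactness glues the two. *)
Lemma near_inf_lower (e : R) : 0 < e -> \forall t \near (0 : R),
  lbound [set H t u | u in Y] (H 0 theta + t * l - e * `|t|).
Proof.
move=> e0.
have low : \forall t \near (0 : R), Y `<=` [set u | Y u ->
    H 0 theta + t * l - e * `|t| <= H t u].
  apply: ((compact_near_coveringP Y).1 cY _ (nbhs (0 : R))
    (fun t u => Y u -> H 0 theta + t * l - e * `|t| <= H t u)) => u Yu.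
  suff : \forall t \near (0 : R) & u' \near u,
      Y u' -> H 0 theta + t * l - e * `|t| <= H t u'.
    move=> [[A B] [/= A0 Bt] AB]; exists (B, A) => //= -[u' t] /= [? ?].
    exact: (AB (t, u')).
  have [->|/eqP ut] := eqVneq u theta.
    move: (Hl e0); apply: filterS => -[t u'] /= h Yu'.
    have := Hle Yu'; move: h; rewrite ler_norml => /andP[]; lra.
  have d0 := Hmin Yu ut.
  set D := H 0 u - H 0 theta; have D0 : 0 < D by rewrite subr_gt0.
  (* Half of the excess [D] pays for the continuity error, the other half for [t * l]; the [+ 1]
     allows [l = 0]. *)
  have l0 : 0 < D / 2 / (`|l| + 1) by rewrite !divr_gt0// ltr_wpDl.
  have near_u : \forall t \near (0 : R) & u' \near u, `|H 0 u - H t u'| <= D / 2.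
    by move/cvgrPdist_le : (Hc Yu) => /(_ (D / 2)); apply; rewrite divr_gt0.
  have near_0 : \forall t \near (0 : R) & u' \near u, `|t| < D / 2 / (`|l| + 1).
    exists ([set t : R | `|t| < D / 2 / (`|l| + 1)], setT) => /= [|[t u'] []//].
    split; last exact: filterT.
    by have := @nbhs0_lt R R^o _ l0.
  apply: filterS2 near_u near_0 => -[t u'] /= h1.
  rewrite ltr_pdivlMr ?ltr_wpDl// => h2 Yu'.
  have := ler_norm (t * l); rewrite normrM.
  have := mulr_ge0 (ltW e0) (normr_ge0 t).
  move: h1; rewrite ler_norml => /andP[_ h1]; have := normr_ge0 t.
  by rewrite /D in h1 h2; lra.
by apply: filterS low => t lowt _ [u Yu <-]; exact: lowt.
Qed.

(** The infimum is squeezed between [near_inf_lower] and the value at [theta]. As [theta] is the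
    only minimizer, the same slope [l] serves for both signs of [t]. *)
Lemma is_derive_inf :
  is_derive (0 : R) (1 : R) (fun t => inf [set H t u | u in Y]) l.
Proof.
apply: is_derive_expansion => e e0.
have -> : inf [set H 0 u | u in Y] = H 0 theta.
  apply/eqP; rewrite eq_le; apply/andP; split.
    by apply: ge_inf; [exists (H 0 theta) => _ [u Yu <-]; exact: Hle|exists theta].
  by apply: lb_le_inf; [exists (H 0 theta), theta|move=> _ [u Yu <-]; exact: Hle].
have up : \forall t \near (0 : R), `|H t theta - H 0 theta - t * l| <= e * `|t|.
  have [[A B] [/= A0 Bt] AB] := Hl e0.
  by apply: filterS A0 => t At; apply: (AB (t, theta)); split => //=; exact: nbhs_singleton.
apply: filterS2 (near_inf_lower e0) up => t lb upt; rewrite addr0.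
have i1 : H 0 theta + t * l - e * `|t| <= inf [set H t u | u in Y].
  by apply: lb_le_inf lb; exists (H t theta), theta.
have i2 : inf [set H t u | u in Y] <= H t theta.
  by apply: ge_inf; [exists (H 0 theta + t * l - e * `|t|)|exists theta].
by move: upt; rewrite !ler_norml => /andP[_ u2]; apply/andP; split; lra.
Qed.
End Infimum.
End Danskin.

(** * Derivatives and continuity of maps with row-vector arguments or values *)

Section Gradients.
Variable R : realType.

Lemma dot_mulmx p n (z : 'rV[R]_p) (A : 'M[R]_(p, n)) (v : 'rV[R]_n) :
  dot (z *m A) v = dot z (v *m A^T).
Proof.
have dotE k (a b : 'rV[R]_k) : dot a b = (a *m b^T) 0 0.
  by rewrite mxE; apply: eq_bigr => i _; rewrite mxE.
by rewrite !dotE trmx_mul trmxK mulmxA.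
Qed.

Lemma is_derive_grad n (f : 'rV[R]_n -> R) (w v : 'rV[R]_n) :
  differentiable f w -> is_derive w v f (dot (grad f w) v).
Proof.
move=> df; split; first exact: diff_derivable.
rewrite deriveE// {1}(row_sum_delta v) linear_sum; apply: eq_bigr => i _.
by rewrite linearZ mxE mulrC -deriveE.
Qed.

Lemma derive_dot_jac n p (g : 'rV[R]_n -> 'rV[R]_p) z (w v : 'rV[R]_n) :
  differentiable g w -> dot (z *m jac g w) v = dot z ('D_v g w).
Proof. by move=> dg; rewrite dot_mulmx trmxK deriveEjacobian. Qed.

Lemma is_derive_coord n p (g : 'rV[R]_n -> 'rV[R]_p) (w v : 'rV[R]_n) i :
  differentiable g w -> is_derive w v (fun w => g w 0 i) ('D_v g w 0 i).
Proof.
move=> dg; have dv : derivable g w v by exact: diff_derivable.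
split; first by move/derivable_mxP : dv; exact.
by rewrite derive_mx// mxE.
Qed.

Lemma is_derive_dot p (u v : R -> 'rV[R]_p) (du dv : 'rV[R]_p) (t : R) :
  (forall i, is_derive t (1 : R) (fun s => u s 0 i) (du 0 i)) ->
  (forall i, is_derive t (1 : R) (fun s => v s 0 i) (dv 0 i)) ->
  is_derive t (1 : R) (fun s => dot (u s) (v s)) (dot (u t) dv + dot (v t) du).
Proof.
move=> hu hv.
have := is_derive_sum (fun i => is_derive_mul (hu i) (hv i)).
rewrite /dot -big_split (_ : \sum_(i < p) (fun s => u s 0 i * v s 0 i) =
  (fun s => \sum_(i < p) u s 0 i * v s 0 i))//.
by apply/funext => s; rewrite fct_sumE.
Qed.

Lemma is_derive_affine p (a b : 'rV[R]_p) (t : R) i :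
  is_derive t (1 : R) (fun s : R => (a + s *: b) 0 i) (b 0 i).
Proof.
have -> : (fun s : R => (a + s *: b) 0 i) = (fun s : R => a 0 i + b 0 i * s).
  by apply/funext => s; rewrite !mxE mulrC.
have := is_deriveD (is_derive_cst (a 0 i) t (1 : R))
  (is_derive_scale (b 0 i) (is_derive_id t (1 : R))).
by rewrite add0r mulr1.
Qed.

Lemma is_derive_comp1 (h k : R -> R) (t dh dk : R) :
  is_derive t (1 : R) h dh -> is_derive (h t) (1 : R) k dk ->
  is_derive t (1 : R) (fun s => k (h s)) (dk * dh).
Proof.
move=> [dht <-] [dkt <-].
have := derive1_comp dht dkt; rewrite !derive1E => <-.
split; last by [].
apply/derivable1_diffP; apply: differentiable_comp.
  exact: (derivable1_diffP _ _).1 dht.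
exact: (derivable1_diffP _ _).1 dkt.
Qed.

(** The squared positive part is differentiable even at its kink, because the first-order remainder
    is at most [t^2]. This is what makes the maximum over [lambda] differentiable. *)
Lemma is_derive_sqr_pos (x : R) :
  is_derive x (1 : R) (fun s => Num.max 0 s ^+ 2) (2 * Num.max 0 x).
Proof.
apply: is_derive_expansion => e e0.
have : \forall t \near (0 : R), `|t| < e by have := @nbhs0_lt R R^o _ e0.
apply: filterS => t te.
have h : `|Num.max 0 (t + x) ^+ 2 - Num.max 0 x ^+ 2 - t * (2 * Num.max 0 x)|
    <= `|t| ^+ 2.
  rewrite real_normK ?num_real// ler_norml.
  by case: (leP 0 x) => x0; case: (leP 0 (t + x)) => tx; apply/andP; split; nra.
by rewrite (le_trans h)// expr2 ler_wpM2r// ltW.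
Qed.

Section Continuity.
Variables (T : topologicalType) (x : T).

Lemma continuous_row n (F : T -> 'rV[R]_n) :
  (forall j, {for x, continuous (fun s => F s 0 j)}) -> {for x, continuous F}.
Proof.
move=> Fc; apply/cvg_ballP => e e0.
have : \forall s \near x, forall j, ball (F x 0 j) e (F s 0 j).
  apply: filter_forall => j; move/cvg_ballP : (Fc j); exact.
apply: filterS => s h; split => // i j; rewrite (ord1 i); exact: h.
Qed.

Lemma continuous_entry n (F : T -> 'rV[R]_n) j :
  {for x, continuous F} -> {for x, continuous (fun s => F s 0 j)}.
Proof.
move=> Fc; apply: (@cvg_comp _ _ _ F (fun M : 'rV[R]_n => M 0 j) _ _ _ Fc).
exact: coord_continuous.
Qed.

Lemma continuous_row_mx n m (F : T -> 'rV[R]_n) (G : T -> 'rV[R]_m) :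
  {for x, continuous F} -> {for x, continuous G} ->
  {for x, continuous (fun s => row_mx (F s) (G s))}.
Proof.
move=> Fc Gc; apply: continuous_row => j.
have E s : row_mx (F s) (G s) 0 j =
    match fintype.split j with inl k => F s 0 k | inr k => G s 0 k end by rewrite mxE.
change ((fun s => row_mx (F s) (G s) 0 j) @ x --> row_mx (F x) (G x) 0 j).
rewrite E (funext E).
by case: (fintype.split j) => k; exact: continuous_entry.
Qed.

Lemma continuous_dot n (F G : T -> 'rV[R]_n) :
  {for x, continuous F} -> {for x, continuous G} ->
  {for x, continuous (fun s => dot (F s) (G s))}.
Proof.
move=> Fc Gc; apply: cvg_big => [|i _]; first exact: add_continuous.
by apply: cvgM; exact: continuous_entry.
Qed.

End Continuity.
End Gradients.

(** * The gap function and its gradient *)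

Section GapGradient.
Variables (R : realType) (n m p : nat) (X : set 'rV[R]_n) (Y : set 'rV[R]_m).
Variables (f : 'rV[R]_(n + m) -> R) (g : 'rV[R]_(n + m) -> 'rV[R]_p).
Variables gamma1 gamma2 : R.
Hypothesis gamma1_gt0 : 0 < gamma1.
Hypothesis gamma2_gt0 : 0 < gamma2.
Implicit Types (x a : 'rV[R]_n) (y b theta : 'rV[R]_m) (z d lambda : 'rV[R]_p).

Lemma is_derive_line0 k (h : 'rV[R]_k -> R) (w v : 'rV[R]_k) (l : R) :
  is_derive w v h l <-> is_derive (0 : R) (1 : R) (fun s => h (w + s *: v)) l.
Proof. by rewrite -is_derive_line scale0r addr0. Qed.

(** The open set turns regularity relative to [D] into regularity in the ambient space, as required
    for perturbations that leave [D]. *)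
Lemma C1_around_near k (V : normedModType R) (D : set 'rV[R]_k)
    (h : 'rV[R]_k -> V) w : C1_around D h -> D w ->
  (\forall u \near w, differentiable h u) /\
  (forall v, {for w, continuous (fun u => 'D_v h u)}).
Proof.
move=> [U [oU DU [dh ch]]] Dw; have nU := open_nbhs_nbhs (conj oU (DU _ Dw)).
split; first exact: filterS nU.
move=> v; have := ch v; rewrite continuous_open_subspace// => /(_ w); apply.
by rewrite inE; exact: DU.
Qed.

Definition lagr z w : R := f w + dot z (g w).

Definition grad_lagr z w : 'rV[R]_(n + m) := grad f w + z *m jac g w.

Lemma is_derive_lagr z w v : differentiable f w -> differentiable g w ->
  is_derive w v (lagr z) (dot (grad_lagr z w) v).
Proof.
move=> df dg; rewrite dotDl derive_dot_jac//.
apply: is_deriveD; first exact: is_derive_grad.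
apply/is_derive_line0.
have := @is_derive_dot R p (fun=> z) (fun s => g (w + s *: v)) 0 ('D_v g w) 0.
rewrite dot0r addr0; apply => i; first by rewrite mxE; exact: is_derive_cst.
by have /is_derive_line0 := is_derive_coord v i dg.
Qed.

(** The objective whose infimum over [Y] is the part [B] of the gap. *)
Definition inner x y z theta : R :=
  lagr z (row_mx x theta) + (2 * gamma1)^-1 * enorm (theta - y) ^+ 2.

Definition grad_inner x y z theta : 'rV[R]_m :=
  rsubmx (grad_lagr z (row_mx x theta)) + gamma1^-1 *: (theta - y).

Lemma is_derive_sqdist k (u v : 'rV[R]_k) (t : R) :
  is_derive t (1 : R) (fun s : R => (2 * gamma1)^-1 * enorm (u + s *: v) ^+ 2)
    (gamma1^-1 * dot (u + t *: v) v).
Proof.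
under eq_fun do rewrite enorm_sqr.
have := is_derive_dot (is_derive_affine u v t) (is_derive_affine u v t).
move=> /(is_derive_scale (2 * gamma1)^-1); congr is_derive.
by field; rewrite gt_eqF.
Qed.

Lemma is_derive_lagr_y x z theta v :
  differentiable f (row_mx x theta) -> differentiable g (row_mx x theta) ->
  is_derive theta v (fun u => lagr z (row_mx x u))
    (dot (rsubmx (grad_lagr z (row_mx x theta))) v).
Proof.
move=> df dg; apply/is_derive_line0.
have /is_derive_line0 := is_derive_lagr z (row_mx 0 v) df dg.
congr is_derive.
  by apply/funext => s; rewrite scale_row_mx scaler0 add_row_mx addr0.
by rewrite dot_lr row_mxKl row_mxKr dot0r add0r.
Qed.

Lemma is_derive_inner x y z theta v :
  differentiable f (row_mx x theta) -> differentiable g (row_mx x theta) ->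
  is_derive theta v (inner x y z) (dot (grad_inner x y z theta) v).
Proof.
move=> df dg; apply/is_derive_line0.
have /is_derive_line0 h1 := is_derive_lagr_y z v df dg.
have := is_deriveD h1 (is_derive_sqdist (theta - y) v 0); congr is_derive.
  apply/funext => s; change (lagr z (row_mx x (theta + s *: v)) +
    (2 * gamma1)^-1 * enorm (theta - y + s *: v) ^+ 2 = inner x y z (theta + s *: v)).
  by rewrite /inner [_ + _ - y]addrAC.
by rewrite scale0r addr0 [RHS]dotDl dotZl.
Qed.

(** Entrywise form of the projection of [z + gamma2 g] onto the orthant. *)
Definition lambda_star x y z : 'rV[R]_p :=
  \row_i Num.max 0 ((z + gamma2 *: g (row_mx x y)) 0 i).

Lemma lambda_star_ge0 x y z : orthant p (lambda_star x y z).
Proof. by move=> i; rewrite mxE le_max lexx. Qed.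

Lemma lambda_star_dot x y z :
  dot (lambda_star x y z) (z + gamma2 *: g (row_mx x y)) =
  dot (lambda_star x y z) (lambda_star x y z).
Proof.
apply: eq_bigr => i _; rewrite !mxE.
by case: (leP 0 (z 0 i + gamma2 * g (row_mx x y) 0 i)); rewrite ?mul0r.
Qed.

Lemma lambda_star_ub x y z lambda : orthant p lambda ->
  dot lambda (z + gamma2 *: g (row_mx x y)) <= dot lambda (lambda_star x y z).
Proof.
by move=> l0; apply: ler_sum => i _; rewrite ler_wpM2l// !mxE le_max lexx orbT.
Qed.

(* The maximum over [lambda] in closed form.  It is meaningful for every [z],
   also outside the orthant: the partial derivatives of [gap] at a boundary point
   of the box involve such [z]. *)
Definition gap_upper x y z : R := f (row_mx x y) +
  (2 * gamma2)^-1 * (dot (lambda_star x y z) (lambda_star x y z) - dot z z).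

(** Up to the factor [1 / (2 gamma2)] and the term [f], the left side is [2 dot lambda (z + gamma2
    g) - |lambda|^2 - |z|^2]. Apply [lambda_star_ub], then [|lambda - lambda_star|^2 >= 0]. *)
Lemma gap_upper_ge x y z lambda : orthant p lambda ->
  lagr lambda (row_mx x y) - (2 * gamma2)^-1 * enorm (lambda - z) ^+ 2
    <= gap_upper x y z.
Proof.
move=> l0; rewrite /lagr -addrA lerD2l.
have := lambda_star_ub x y z l0; set ls := lambda_star x y z.
have := dot_ge0 (lambda - ls).
rewrite enorm_sqr !(dotBl, dotBr) dotDr dotZr (dotC z) (dotC ls) => h1 h2.
have g2 : 0 < (2 * gamma2)^-1 by rewrite invr_gt0 mulr_gt0.
rewrite -(ler_pM2l (_ : 0 < 2 * gamma2)) ?mulr_gt0//.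
rewrite mulrBr !mulVKf ?gt_eqF ?mulr_gt0//; lra.
Qed.

Lemma gap_upper_eq x y z :
  lagr (lambda_star x y z) (row_mx x y)
    - (2 * gamma2)^-1 * enorm (lambda_star x y z - z) ^+ 2 = gap_upper x y z.
Proof.
rewrite /lagr -addrA; congr (_ + _).
have := lambda_star_dot x y z; set ls := lambda_star x y z.
rewrite enorm_sqr !(dotBl, dotBr) dotDr dotZr (dotC z) => h.
rewrite -h; field; rewrite gt_eqF//.
Qed.

(** The maximized expression is a function of [lambda] minus a function of [theta], so the supremum
    splits. The lower bound ensures that the infimum is a genuine one. *)
Lemma gapE x y z : Y !=set0 -> has_lbound [set inner x y z u | u in Y] ->
  gap Y f g gamma1 gamma2 x y z =
  gap_upper x y z - inf [set inner x y z u | u in Y].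
Proof.
move=> [u0 Yu0] lb; rewrite /gap; set S := [set v | _].
have ubS : ubound S (gap_upper x y z - inf [set inner x y z u | u in Y]).
  move=> _ [u [lambda [Yu l0 ->]]].
  have := gap_upper_ge x y z l0.
  have : inf [set inner x y z u | u in Y] <= inner x y z u.
    by apply: ge_inf => //; exists u.
  rewrite /inner /lagr /lagrangian; lra.
have S0 u : Y u -> S (gap_upper x y z - inner x y z u).
  move=> Yu; exists u, (lambda_star x y z); split => //.
    exact: lambda_star_ge0.
  by rewrite -gap_upper_eq /inner /lagr /lagrangian; lra.
apply/eqP; rewrite eq_le; apply/andP; split.
  by apply: ge_sup => //; exists (gap_upper x y z - inner x y z u0); exact: S0.
rewrite lerBlDr -lerBlDl; apply: lb_le_inf; first by exists (inner x y z u0), u0.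
move=> _ [u Yu <-]; rewrite lerBlDr -lerBlDl.
by apply: ub_le_sup; [exists (gap_upper x y z - inf [set inner x y z u | u in Y])|exact: S0].
Qed.
End GapGradient.

(** * Derivative of the minimum over [theta] *)

Section GapDerivative.
Variables (R : realType) (n m p : nat) (X : set 'rV[R]_n) (Y : set 'rV[R]_m).
Variables (f : 'rV[R]_(n + m) -> R) (g : 'rV[R]_(n + m) -> 'rV[R]_p).
Variables gamma1 gamma2 : R.
Hypothesis gamma1_gt0 : 0 < gamma1.
Hypothesis gamma2_gt0 : 0 < gamma2.
Hypothesis fC1 : C1_around (setprod_row X Y) f.
Hypothesis gC1 : C1_around (setprod_row X Y) g.
Hypothesis cY : compact Y.
Implicit Types (x a : 'rV[R]_n) (y b theta : 'rV[R]_m) (z d lambda : 'rV[R]_p).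

Local Notation inner := (inner f g gamma1).
Local Notation gap := (gap Y f g gamma1 gamma2).

Lemma row_mx_setprod x y : X x -> Y y -> setprod_row X Y (row_mx x y).
Proof. by move=> Xx Yy; split; rewrite (row_mxKl, row_mxKr). Qed.

Section Line.
Variables (x a : 'rV[R]_n) (y b : 'rV[R]_m) (z d : 'rV[R]_p).
Hypothesis Xx : X x.

Let H (t : R) theta := inner (x + t *: a) (y + t *: b) (z + t *: d) theta.

Let W (q : R * 'rV[R]_m) : 'rV[R]_(n + m) := row_mx (x + q.1 *: a) q.2.

Let v : 'rV[R]_(n + m) := row_mx a 0.

Let dH (t : R) theta : R := 'D_v f (W (t, theta))
  + (dot (z + t *: d) ('D_v g (W (t, theta))) + dot (g (W (t, theta))) d)
  + gamma1^-1 * dot (theta - y + t *: - b) (- b).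

Let affine_continuous k (u w : 'rV[R]_k) (q : R * 'rV[R]_m) :
  {for q, continuous (fun q : R * 'rV[R]_m => u + q.1 *: w)}.
Proof.
apply: cvgD; first exact: cvg_cst.
by apply: cvgZ; [exact: cvg_fst|exact: cvg_cst].
Qed.

Let W_continuous q : {for q, continuous W}.
Proof.
by apply: continuous_row_mx; [exact: affine_continuous|exact: cvg_snd].
Qed.

Let W0 theta : W (0, theta) = row_mx x theta.
Proof. by rewrite /W /= scale0r addr0. Qed.

Let comp_continuous (V : topologicalType) (h : 'rV[R]_(n + m) -> V) theta :
  {for row_mx x theta, continuous h} ->
  {for (0 : R, theta), continuous (fun q => h (W q))}.
Proof.
move=> hc; apply: continuous_comp; first exact: W_continuous.
by rewrite W0.
Qed.

Let sqdist_continuous theta :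
  {for (0 : R, theta), continuous (fun q : R * 'rV[R]_m => q.2 - y + q.1 *: - b)}.
Proof.
apply: cvgD; first by apply: cvgB; [exact: cvg_snd|exact: cvg_cst].
by apply: cvgZ; [exact: cvg_fst|exact: cvg_cst].
Qed.

Let HE t theta : H t theta = f (W (t, theta)) + dot (z + t *: d) (g (W (t, theta)))
   + (2 * gamma1)^-1 * enorm (theta - y + t *: - b) ^+ 2.
Proof. by rewrite /H /inner /lagr opprD addrA scalerN. Qed.

Let H_continuous theta : Y theta ->
  {for (0 : R, theta), continuous (fun q : R * 'rV[R]_m => H q.1 q.2)}.
Proof.
move=> Yt; have XYt := row_mx_setprod Xx Yt.
have fc : {for row_mx x theta, continuous f}.
  by apply: differentiable_continuous; apply: nbhs_singleton (C1_around_near fC1 XYt).1.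
have gc : {for row_mx x theta, continuous g}.
  by apply: differentiable_continuous; apply: nbhs_singleton (C1_around_near gC1 XYt).1.
have E : (fun q : R * 'rV[R]_m => H q.1 q.2) = (fun q => f (W q) + dot (z + q.1 *: d) (g (W q))
   + (2 * gamma1)^-1 * dot (q.2 - y + q.1 *: - b) (q.2 - y + q.1 *: - b)).
  by apply/funext => -[t u]; rewrite HE enorm_sqr.
rewrite E; have c1 := comp_continuous fc.
have c2 := continuous_dot (@affine_continuous _ z d (0, theta)) (comp_continuous gc).
have c3 := continuous_dot (@sqdist_continuous theta) (@sqdist_continuous theta).
have c0 := @cst_continuous (R * 'rV[R]_m)%type R (2 * gamma1)^-1 (0, theta).
exact: (cvgD (cvgD c1 c2) (cvgM c0 c3)).
Qed.

Let dH_continuous theta : Y theta ->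
  {for (0 : R, theta), continuous (fun q : R * 'rV[R]_m => dH q.1 q.2)}.
Proof.
move=> Yt; have XYt := row_mx_setprod Xx Yt.
have gc : {for row_mx x theta, continuous g}.
  by apply: differentiable_continuous; apply: nbhs_singleton (C1_around_near gC1 XYt).1.
have fc := (C1_around_near fC1 XYt).2 v; have dgc := (C1_around_near gC1 XYt).2 v.
have E : (fun q : R * 'rV[R]_m => dH q.1 q.2) = (fun q => 'D_v f (W q)
  + (dot (z + q.1 *: d) ('D_v g (W q)) + dot (g (W q)) d)
  + gamma1^-1 * dot (q.2 - y + q.1 *: - b) (- b)).
  by apply/funext => -[t u].
rewrite E; have c1 := comp_continuous fc.
have c2 := continuous_dot (@affine_continuous _ z d (0, theta)) (comp_continuous dgc).
have cst_cont (V : topologicalType) (c : V) :=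
  @cst_continuous (R * 'rV[R]_m)%type V c (0, theta).
have c3 := continuous_dot (comp_continuous gc) (cst_cont _ d).
have c4 := continuous_dot (@sqdist_continuous theta) (cst_cont _ (- b)).
exact: (cvgD (cvgD c1 (cvgD c2 c3)) (cvgM (cst_cont _ gamma1^-1) c4)).
Qed.

Let near_is_derive theta : Y theta ->
  \forall t \near (0 : R) & u \near theta, is_derive t (1 : R) (H ^~ u) (dH t u).
Proof.
move=> Yt; have XYt := row_mx_setprod Xx Yt.
have near_diff (V : normedModType R) (h : 'rV[R]_(n + m) -> V) :
    C1_around (setprod_row X Y) h ->
    \forall q \near (0 : R, theta), differentiable h (W q).
  move=> hC; have := (C1_around_near hC XYt).1; rewrite -W0 => hn.
  exact: (W_continuous hn).
have := near_diff _ _ gC1; have := near_diff _ _ fC1.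
apply: filterS2 => -[t u] /= df dg.
have E s : W (s, u) = row_mx x u + s *: v.
  by rewrite /W /v scale_row_mx scaler0 add_row_mx addr0.
have h1 : is_derive t (1 : R) (fun s => f (W (s, u))) ('D_v f (W (t, u))).
  rewrite (funext (fun s => congr1 f (E s))); apply/is_derive_line; rewrite -E.
  by split => //; exact: diff_derivable.
have h2 i : is_derive t (1 : R) (fun s => g (W (s, u)) 0 i) ('D_v g (W (t, u)) 0 i).
  rewrite (funext (fun s => congr1 (fun w => g w 0 i) (E s))).
  apply/(is_derive_line (fun w => g w 0 i)); rewrite -E.
  exact: is_derive_coord.
have := is_deriveD (is_deriveD h1 (is_derive_dot (is_derive_affine z d t) h2))
  (is_derive_sqdist gamma1_gt0 (u - y) (- b) t).
by congr is_derive; apply/funext => s; rewrite HE.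
Qed.

(* Off [X] the infimum over [Y] could be infinite, in which case [inf] and [gap]
   take junk values; close to [(x, y, z)] this does not happen. *)
Lemma near_inner_lbound theta : Y theta ->
  (forall u, Y u -> u <> theta -> inner x y z theta < inner x y z u) ->
  \forall t \near (0 : R), has_lbound
    [set inner (x + t *: a) (y + t *: b) (z + t *: d) u | u in Y].
Proof.
move=> Yt min; have := @near_inf_lower R _ Y H theta (dH 0 theta) cY.
have H0 u : H 0 u = inner x y z u by rewrite /H !scale0r !addr0.
move=> /(_ _ H_continuous (mvt_near (near_is_derive Yt) (dH_continuous Yt)) 1 ltr01).
move=> near0; apply: filterS (near0 _) => [t lbt|u Yu ut]; last by rewrite !H0; exact: min.
by exists (H 0 theta + t * dH 0 theta - 1 * `|t|).
Qed.

Lemma is_derive_inf_inner theta : Y theta ->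
  (forall u, Y u -> u <> theta -> inner x y z theta < inner x y z u) ->
  is_derive (0 : R) (1 : R) (fun t => inf
    [set inner (x + t *: a) (y + t *: b) (z + t *: d) u | u in Y])
    (dot (grad_lagr f g z (row_mx x theta)) (row_mx a 0)
     + dot (g (row_mx x theta)) d - gamma1^-1 * dot (theta - y) b).
Proof.
move=> Yt min.
have H0 u : H 0 u = inner x y z u by rewrite /H !scale0r !addr0.
have := @is_derive_inf R _ Y H theta (dH 0 theta) cY Yt.
move=> /(_ _ H_continuous (mvt_near (near_is_derive Yt) (dH_continuous Yt))).
have XYt := row_mx_setprod Xx Yt.
have df := nbhs_singleton (C1_around_near fC1 XYt).1.
have dg := nbhs_singleton (C1_around_near gC1 XYt).1.
have -> : dH 0 theta = dot (grad_lagr f g z (row_mx x theta)) (row_mx a 0)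
     + dot (g (row_mx x theta)) d - gamma1^-1 * dot (theta - y) b.
  rewrite /dH W0 !scale0r !addr0 dotNr mulrN /grad_lagr.
  rewrite [dot (_ + _ *m _) _]dotDl derive_dot_jac//.
  by rewrite (derive_val (is_derive := is_derive_grad v df)) !addrA.
by apply => u Yu ut; rewrite !H0; exact: min.
Qed.
End Line.

End GapDerivative.

(** * Gradient of the penalized objective *)

Section PsiGradient.
Variables (R : realType) (n m p : nat) (X : set 'rV[R]_n) (Y : set 'rV[R]_m).
Variables (F f : 'rV[R]_(n + m) -> R) (g : 'rV[R]_(n + m) -> 'rV[R]_p).
Variables gamma1 gamma2 : R.
Hypothesis gamma1_gt0 : 0 < gamma1.
Hypothesis gamma2_gt0 : 0 < gamma2.
Hypothesis fC1 : C1_around (setprod_row X Y) f.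
Hypothesis gC1 : C1_around (setprod_row X Y) g.
Hypothesis cY : compact Y.
Implicit Types (x a : 'rV[R]_n) (y b theta : 'rV[R]_m) (z d lambda : 'rV[R]_p).

Local Notation inner := (inner f g gamma1).
Local Notation gap := (gap Y f g gamma1 gamma2).
Local Notation glagr := (grad_lagr f g).
Local Notation lambda_star := (lambda_star g gamma2).
Local Notation gap_upper := (gap_upper f g gamma2).

(** With [theta] and [lambda] optimal this is the gradient of the gap; with the iterates
    [theta_(k+1)], [lambda_(k+1)] it is the gap part of the search direction. Keeping them as
    arguments lets one estimate compare the two. *)
Definition gap_dir x y z theta lambda : 'rV[R]_(n + m + p) :=
  row3 (lsubmx (glagr lambda (row_mx x y)) - lsubmx (glagr z (row_mx x theta)))
       (rsubmx (glagr lambda (row_mx x y)) - gamma1^-1 *: (y - theta))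
       (- (gamma2^-1 *: (z - lambda)) - g (row_mx x theta)).

Lemma dot_row3 (a a' : 'rV[R]_n) (b b' : 'rV[R]_m) (d d' : 'rV[R]_p) :
  dot (row3 a b d) (row3 a' b' d') = dot a a' + dot b b' + dot d d'.
Proof. by rewrite !dot_row. Qed.

Lemma is_derive_gap_upper x y z a b d :
  differentiable f (row_mx x y) -> differentiable g (row_mx x y) ->
  is_derive (0 : R) (1 : R)
    (fun t => gap_upper (x + t *: a) (y + t *: b) (z + t *: d))
    (dot (glagr (lambda_star x y z) (row_mx x y)) (row_mx a b)
     + gamma2^-1 * dot (lambda_star x y z - z) d).
Proof.
move=> df dg; set v := row_mx a b.
have E (t : R) : row_mx (x + t *: a) (y + t *: b) = row_mx x y + t *: v.
  by rewrite /v scale_row_mx add_row_mx.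
have h1 := (is_derive_line0 _ _ _ _).1 (is_derive_grad v df).
pose u i (t : R) := (z + t *: d) 0 i + gamma2 * g (row_mx x y + t *: v) 0 i.
have hu i : is_derive (0 : R) (1 : R) (u i) ((d + gamma2 *: 'D_v g (row_mx x y)) 0 i).
  rewrite !mxE; apply: is_deriveD; first exact: is_derive_affine.
  apply: is_derive_scale.
  exact: (is_derive_line0 (fun w => g w 0 i) _ _ _).1 (is_derive_coord v i dg).
have u0 i : u i 0 = (z + gamma2 *: g (row_mx x y)) 0 i.
  by rewrite /u !scale0r !addr0 !mxE.
have h2 i : is_derive (0 : R) (1 : R) (fun t => Num.max 0 (u i t) ^+ 2)
    (2 * Num.max 0 (u i 0) * ((d + gamma2 *: 'D_v g (row_mx x y)) 0 i)).
  exact: (is_derive_comp1 (hu i) (is_derive_sqr_pos (u i 0))).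
have h3 := is_derive_sum h2.
have h4 := is_derive_dot (is_derive_affine z d (0 : R)) (is_derive_affine z d (0 : R)).
have h5 := is_deriveD h1 (is_derive_scale (2 * gamma2)^-1 (is_deriveB h3 h4)).
move: h5; rewrite scale0r addr0; congr is_derive.
  apply/funext => t; rewrite /gap_upper E.
  change (f (row_mx x y + t *: v) + (2 * gamma2)^-1 *
    ((\sum_(i < p) (fun t => Num.max 0 (u i t) ^+ 2)) t - dot (z + t *: d) (z + t *: d))
    = f (row_mx x y + t *: v) + (2 * gamma2)^-1 *
    (dot (lambda_star (x + t *: a) (y + t *: b) (z + t *: d))
       (lambda_star (x + t *: a) (y + t *: b) (z + t *: d))
     - dot (z + t *: d) (z + t *: d))).
  congr (_ + _ * (_ - _)); rewrite fct_sumE; apply: eq_bigr => i _.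
  by rewrite expr2 /lambda_star E !mxE /u !mxE.
have -> : \sum_(i < p) 2 * Num.max 0 (u i 0) * (d + gamma2 *: 'D_v g (row_mx x y)) 0 i
    = 2 * dot (lambda_star x y z) (d + gamma2 *: 'D_v g (row_mx x y)).
  by rewrite mulr_sumr; apply: eq_bigr => i _; rewrite u0 [in RHS]mxE mulrA.
rewrite dotBl dotDr dotZr [dot (_ + _ *m _) _]dotDl derive_dot_jac//.
by field; rewrite gt_eqF.
Qed.

Section AtPoint.
Variables (x : 'rV[R]_n) (y : 'rV[R]_m) (z : 'rV[R]_p) (theta : 'rV[R]_m).
Hypothesis Xx : X x.
Hypothesis Yy : Y y.
Hypothesis Yt : Y theta.
Hypothesis theta_min :
  forall u, Y u -> u <> theta -> inner x y z theta < inner x y z u.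

Lemma is_derive_gap a b d :
  is_derive (0 : R) (1 : R) (fun t => gap (x + t *: a) (y + t *: b) (z + t *: d))
    (dot (gap_dir x y z theta (lambda_star x y z)) (row3 a b d)).
Proof.
have XY := row_mx_setprod Xx Yy.
have df := nbhs_singleton (C1_around_near fC1 XY).1.
have dg := nbhs_singleton (C1_around_near gC1 XY).1.
have h1 := is_derive_gap_upper z a b d df dg.
have h2 := is_derive_inf_inner gamma1_gt0 fC1 gC1 cY a b d Xx Yt theta_min.
have lb := near_inner_lbound gamma1_gt0 fC1 gC1 cY a b d Xx Yt theta_min.
(* The splitting [gapE] is available only for [t] near 0, where [inner] stays bounded below on
   [Y]. *)
apply: near_eq_is_derive (is_derive_eq (is_deriveB h1 h2) _).
  by apply: filterS lb => t lb; rewrite gapE//; exists theta.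
rewrite /gap_dir dot_row3.
move: (glagr (lambda_star x y z) (row_mx x y)) (glagr z (row_mx x theta)) => A B.
have := dot_lr A (row_mx a b); have := dot_lr B (row_mx a 0).
rewrite !row_mxKl !row_mxKr dot0r => -> ->.
rewrite !dotBl dotNl !dotZl !dotBl; ring.
Qed.

Lemma is_derive_psi c : differentiable F (row_mx x y) ->
  (forall v, is_derive (row3 x y z) v
    (fun w => psi Y F f g gamma1 gamma2 c
       (lsubmx (lsubmx w)) (rsubmx (lsubmx w)) (rsubmx w))
    (dot (row_mx (grad F (row_mx x y)) 0
       + c *: gap_dir x y z theta (lambda_star x y z)) v)).
Proof.
move=> dF v; apply/is_derive_line0.
set a := lsubmx (lsubmx v); set b := rsubmx (lsubmx v); set d := rsubmx v.
have vE : v = row3 a b d by rewrite /row3 !hsubmxK.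
have E (t : R) : row3 x y z + t *: v = row3 (x + t *: a) (y + t *: b) (z + t *: d).
  by rewrite vE /row3 !scale_row_mx !add_row_mx.
have h1 := (is_derive_line0 _ _ _ _).1 (is_derive_grad (row_mx a b) dF).
have := is_deriveD h1 (is_derive_scale c (is_derive_gap a b d)).
congr is_derive.
  apply/funext => t; rewrite E /row3 !row_mxKl !row_mxKr /psi.
  by rewrite -add_row_mx -scale_row_mx.
move: (gap_dir _ _ _ _ _) (grad F _) => A B.
rewrite [RHS]dotDl dotZl vE /row3 [dot (row_mx B 0) _]dot_row.
by rewrite dot0l addr0.
Qed.

Lemma grad_psi_dir c : differentiable F (row_mx x y) ->
  grad_psi Y F f g gamma1 gamma2 c (row3 x y z) =
  row_mx (grad F (row_mx x y)) 0 + c *: gap_dir x y z theta (lambda_star x y z).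
Proof.
move=> dF; apply/rowP => i; rewrite mxE.
by rewrite (derive_val (is_derive := is_derive_psi c dF _)) dot_delta.
Qed.

End AtPoint.
End PsiGradient.

(** * Projected gradient steps *)

Section Steps.
Variable R : realType.

Lemma compact_enorm_bound n (D : set 'rV[R]_n) : compact D ->
  exists2 B : R, 0 <= B & forall u, D u -> enorm u <= B.
Proof.
move=> /compact_bounded/ex_strict_bound_gt0[k k0 kD].
exists (\sum_(i < n) k); first by apply: sumr_ge0 => i _; exact: ltW.
move=> u Du; rewrite (le_trans (enorm_le_sum u))//; apply: ler_sum => i _.
rewrite (le_trans _ (ltW (kD _ Du)))//.
by rewrite /Num.Def.normr/= mx_normrE; apply: (le_bigmax _ _ (0, i)).
Qed.

Lemma mnorm_le_add p n (A B : 'M[R]_(p, n)) : mnorm A <= mnorm (A - B) + mnorm B.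
Proof.
apply: ge_sup => [|_ [z z1 <-]].
  by exists (enorm ((0 : 'rV[R]_p) *m A)), 0 => // i; rewrite mxE normr0.
rewrite -{1}(subrK B A) mulmxDr (le_trans (enormD _ _))//.
by apply: lerD; rewrite -[leRHS]mul1r enorm_mulmx.
Qed.

Section ProjectedGradient.
Variables (n : nat) (D : set 'rV[R]_n) (h : 'rV[R]_n -> R)
  (q : 'rV[R]_n -> 'rV[R]_n) (L : R).
Hypothesis cD : cvx D.
Hypothesis hq : forall w v, D w -> is_derive w v h (dot (q w) v).
Hypothesis qL : lipschitz_vec D L q.

(** Growth at [s], descent from [u] to [t], strong convexity at [u] and the projection inequality
    tested at [s] combine, with [eta L <= 1], to [(1 + eta mu) |t - s|^2 <= (1 - eta mu) |u - s|^2].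
    The extra term on the left is then dropped. *)
Lemma proj_gradient_contraction (mu eta : R) (s t u : 'rV[R]_n) :
  0 <= mu -> 0 < eta -> eta * L <= 1 -> D u -> D s ->
  (forall v, D v -> h s + mu / 2 * enorm (v - s) ^+ 2 <= h v) ->
  (forall v, D v -> h u + dot (q u) (v - u) + mu / 2 * enorm (v - u) ^+ 2 <= h v) ->
  is_proj D (u - eta *: q u) t ->
  enorm (t - s) ^+ 2 <= (1 - eta * mu) * enorm (u - s) ^+ 2.
Proof.
move=> mu0 eta0 etaL Du Ds growth sconv pt.
have Dt := pt.1; have vi := proj_vi cD pt Ds.
have d := descent cD hq qL Du Dt; have gt := growth _ Dt; have su := sconv _ Ds.
have N1 : enorm (u - s) ^+ 2 = enorm (t - s) ^+ 2 + enorm (t - u) ^+ 2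
    - 2 * dot (t - u) (t - s).
  by rewrite !enorm_sqr !(dotBl, dotBr) (dotC u t) (dotC s t) (dotC s u); ring.
have N2 : dot (u - eta *: q u - t) (s - t) =
    dot (t - u) (t - s) + eta * (dot (q u) (t - u) - dot (q u) (s - u)).
  by rewrite !(dotBl, dotBr) !dotZl; ring.
have us : enorm (s - u) ^+ 2 = enorm (u - s) ^+ 2 by rewrite enormB.
have A0 := sqr_ge0 (enorm (t - u)); have B0 := sqr_ge0 (enorm (t - s)).
rewrite us in su; rewrite N2 in vi; rewrite mulrBl mul1r.
move: (enorm (u - s) ^+ 2) (enorm (t - s) ^+ 2) (enorm (t - u) ^+ 2)
  (dot (t - u) (t - s)) N1 A0 B0 vi d gt su => a b c e -> c0 b0 vi d gt su.
have k1 : mu / 2 * b <= dot (q u) (t - u) - dot (q u) (s - u) + L / 2 * c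
    - mu / 2 * (b + c - 2 * e) by lra.
have k2 := ler_wpM2l (ltW eta0) k1.
have k3 := ler_wpM2r c0 etaL.
have k4 := mulr_ge0 (mulr_ge0 (ltW eta0) mu0) b0.
lra.
Qed.

(** Descent combined with the projection inequality tested at [w] itself. The direction [d] may
    differ from the gradient, and Cauchy-Schwarz pays for the mismatch. *)
Lemma proj_step_descent (alpha : R) (d w w' : 'rV[R]_n) :
  0 < alpha -> D w -> is_proj D (w - alpha *: d) w' ->
  h w' <= h w - (alpha^-1 - L / 2) * enorm (w' - w) ^+ 2
    + enorm (q w - d) * enorm (w' - w).
Proof.
move=> a0 Dw pw; have := descent cD hq qL Dw pw.1.
have := proj_vi cD pw Dw.
have -> : dot (w - alpha *: d - w') (w - w') =
    enorm (w' - w) ^+ 2 + alpha * dot d (w' - w).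
  by rewrite enorm_sqr !(dotBl, dotBr) !dotZl (dotC w w'); ring.
have := cauchy_schwarz (q w - d) (w' - w); rewrite dotBl => h1 h2 h3.
have h4 : alpha^-1 * enorm (w' - w) ^+ 2 + dot d (w' - w) <= 0.
  by rewrite -(pmulr_rle0 _ a0) mulrDr mulVKf ?gt_eqF.
lra.
Qed.

End ProjectedGradient.
End Steps.

(** * Lipschitz estimates *)

Section LipschitzData.
Variables (R : realType) (n m p : nat) (X : set 'rV[R]_n) (Y : set 'rV[R]_m).
Variables (f : 'rV[R]_(n + m) -> R) (g : 'rV[R]_(n + m) -> 'rV[R]_p).
Variables (r Lf Lg Lg1 Lg2 gamma1 gamma2 : R).
Hypothesis r_ge0 : 0 <= r.
Hypothesis gamma1_gt0 : 0 < gamma1.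
Hypothesis gamma2_gt0 : 0 < gamma2.
Hypothesis cX : compact X.
Hypothesis cY : compact Y.
Hypothesis A2 : assumptionA2 X Y f Lf.
Hypothesis A3 : assumptionA3 X Y g Lg Lg1 Lg2.
Implicit Types (x a : 'rV[R]_n) (y b theta : 'rV[R]_m) (z d lambda : 'rV[R]_p).
Implicit Types (w : 'rV[R]_(n + m)).

Local Notation D := (setprod_row X Y).
Local Notation glagr := (grad_lagr f g).
Local Notation lambda_star := (lambda_star g gamma2).
Local Notation gap_dir := (gap_dir f g gamma1 gamma2).

Let Lf0 : 0 <= Lf. Proof. by have [] := A2. Qed.
Let Lg0 : 0 <= Lg. Proof. by have [[]] := A3. Qed.
Let Lg10 : 0 <= Lg1. Proof. by have [[]] := A3. Qed.
Let Lg20 : 0 <= Lg2. Proof. by have [[]] := A3. Qed.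
Let fC1 : C1_around D f. Proof. by have [] := A2. Qed.
Let gC1 : C1_around D g. Proof. by have [] := A3. Qed.

Lemma lsubmxB k l1 l2 (u v : 'M[R]_(k, l1 + l2)) :
  lsubmx (u - v) = lsubmx u - lsubmx v.
Proof. by apply/matrixP => i j; rewrite !mxE. Qed.

Lemma rsubmxB k l1 l2 (u v : 'M[R]_(k, l1 + l2)) :
  rsubmx (u - v) = rsubmx u - rsubmx v.
Proof. by apply/matrixP => i j; rewrite !mxE. Qed.

Lemma lsub_mulmx k l1 l2 (z : 'rV[R]_k) (A : 'M[R]_(k, l1 + l2)) :
  lsubmx (z *m A) = z *m lsubmx A.
Proof. by rewrite -{1}[A]hsubmxK mul_mx_row row_mxKl. Qed.

Lemma rsub_mulmx k l1 l2 (z : 'rV[R]_k) (A : 'M[R]_(k, l1 + l2)) :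
  rsubmx (z *m A) = z *m rsubmx A.
Proof. by rewrite -{1}[A]hsubmxK mul_mx_row row_mxKr. Qed.

Lemma enorm_le_lr k l (u : 'rV[R]_(k + l)) :
  enorm u <= enorm (lsubmx u) + enorm (rsubmx u).
Proof. by rewrite -{1}(hsubmxK u) enorm_row. Qed.

Lemma enorm_mulmx_lr k l1 l2 (B : R) (z : 'rV[R]_k) (A : 'M[R]_(k, l1 + l2)) :
  0 <= B -> (forall i, `|z 0 i| <= B) ->
  enorm (z *m A) <= B * (mnorm (lsubmx A) + mnorm (rsubmx A)).
Proof.
move=> B0 zB; apply: le_trans (enorm_le_lr _) _.
by rewrite lsub_mulmx rsub_mulmx mulrDr lerD// enorm_mulmx.
Qed.

Lemma setprod_enorm_bound :
  exists2 B : R, 0 <= B & forall w, D w -> enorm w <= B.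
Proof.
have [BX BX0 hX] := compact_enorm_bound cX.
have [BY BY0 hY] := compact_enorm_bound cY.
exists (BX + BY); first exact: addr_ge0.
by move=> w [/hX ? /hY ?]; rewrite (le_trans (enorm_le_lr w))// lerD.
Qed.

(** Compactness of [X] and [Y] enters here: a Lipschitz map on a bounded set is bounded. *)
Lemma lipschitz_mx_bound k l (h : 'rV[R]_(n + m) -> 'M[R]_(k, l)) (L : R) :
  0 <= L -> lipschitz_mx D L h ->
  exists2 M : R, 0 <= M & forall w, D w -> mnorm (h w) <= M.
Proof.
move=> L0 hL; have [[w0 Dw0]|De] := pselect (D !=set0); last first.
  by exists 0 => // w Dw; case: De; exists w.
have [B B0 hB] := setprod_enorm_bound.
exists (L * (B + B) + mnorm (h w0)).
  by rewrite !(addr_ge0, mulr_ge0)// mnorm_ge0.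
move=> w Dw; rewrite (le_trans (mnorm_le_add _ (h w0)))// lerD2r.
rewrite (le_trans (hL _ _ Dw Dw0))// ler_wpM2l//.
by rewrite (le_trans (enormD _ _))// enormN lerD// hB.
Qed.

Lemma lipschitz_vec_bound l (h : 'rV[R]_(n + m) -> 'rV[R]_l) (L : R) :
  0 <= L -> lipschitz_vec D L h ->
  exists2 M : R, 0 <= M & forall w, D w -> enorm (h w) <= M.
Proof.
move=> L0 hL; have [[w0 Dw0]|De] := pselect (D !=set0); last first.
  by exists 0 => // w Dw; case: De; exists w.
have [B B0 hB] := setprod_enorm_bound.
exists (L * (B + B) + enorm (h w0)).
  by rewrite !(addr_ge0, mulr_ge0)// enorm_ge0.
move=> w Dw; rewrite -(subrK (h w0) (h w)) (le_trans (enormD _ _))// lerD2r.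
rewrite (le_trans (hL _ _ Dw Dw0))// ler_wpM2l//.
by rewrite (le_trans (enormD _ _))// enormN lerD// hB.
Qed.

Lemma jac_lipschitz (B : R) z w w' : 0 <= B -> (forall i, `|z 0 i| <= B) ->
  D w -> D w' ->
  enorm (z *m jac g w - z *m jac g w') <= B * (Lg1 + Lg2) * enorm (w - w').
Proof.
move=> B0 zB Dw Dw'; have [_ _ _ _ [h1 h2]] := A3.
have {h1} h1 := h1 _ _ Dw Dw'; have {h2} h2 := h2 _ _ Dw Dw'.
rewrite /jac_x /jac_y !hsubmxK in h1 h2.
move: (jac g w) (jac g w') h1 h2 => J J'; rewrite -lsubmxB -rsubmxB => h1 h2.
rewrite -mulmxBr; apply: le_trans (enorm_mulmx_lr _ B0 zB) _.
by rewrite -mulrA mulrDl ler_wpM2l// lerD.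
Qed.

Lemma jac_bound : exists2 M : R, 0 <= M &
  forall z w, D w -> enorm (z *m jac g w) <= M * enorm z.
Proof.
have [_ _ _ _ [h1 h2]] := A3.
have [M1 M10 hM1] := lipschitz_mx_bound Lg10 h1.
have [M2 M20 hM2] := lipschitz_mx_bound Lg20 h2.
exists (M1 + M2); first exact: addr_ge0.
move=> z w Dw; have := hM1 _ Dw; have := hM2 _ Dw.
rewrite /jac_x /jac_y !hsubmxK; move: (jac g w) => J k2 k1.
apply: le_trans (enorm_mulmx_lr J (enorm_ge0 z) (abs_le_enorm z)) _.
by rewrite mulrC ler_wpM2r ?enorm_ge0// lerD.
Qed.

(** The bilinear term splits as [z (J - J') + (z - z') J'], so a bound on the multiplier is required
    of [z] only. *)
Lemma grad_lagr_lipschitz (B : R) : 0 <= B -> exists2 C : R, 0 <= C &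
  forall z z' w w', (forall i, `|z 0 i| <= B) -> D w -> D w' ->
  enorm (glagr z w - glagr z' w') <= C * (enorm (w - w') + enorm (z - z')).
Proof.
move=> B0; have [M M0 hM] := jac_bound; have [_ _ _ hf] := A2.
exists (Lf + B * (Lg1 + Lg2) + M); first by rewrite !(addr_ge0, mulr_ge0).
move=> z z' w w' zB Dw Dw'.
have -> : glagr z w - glagr z' w' = (grad f w - grad f w')
    + ((z *m jac g w - z *m jac g w') + (z - z') *m jac g w').
  rewrite /grad_lagr.
  move: (jac g w) (jac g w') (grad f w) (grad f w') => J J' G G'.
  rewrite mulmxBl opprD addrACA; congr (_ + _).
  by rewrite addrA subrK.
apply: le_trans (enormD _ _) _.
have h1 := hf _ _ Dw Dw'; have h2 := enormD (z *m jac g w - z *m jac g w') ((z - z') *m jac g w').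
have h3 := jac_lipschitz B0 zB Dw Dw'; have h4 := hM (z - z') _ Dw'.
have h5 := mulr_ge0 Lf0 (enorm_ge0 (z - z')).
have h6 := mulr_ge0 M0 (enorm_ge0 (w - w')).
have h7 := mulr_ge0 (mulr_ge0 B0 (addr_ge0 Lg10 Lg20)) (enorm_ge0 (z - z')).
move: h1 h2 h3 h4 h5 h6 h7.
move: (enorm (grad f w - grad f w')) (enorm (z *m jac g w - z *m jac g w'))
  (enorm ((z - z') *m jac g w')) (enorm (_ + _)) (enorm (w - w')) (enorm (z - z')) (B * (Lg1 + Lg2)).
move=> a1 a2 a3 a4 a5 a6 P; lra.
Qed.

Lemma box_abs z i : box p r z -> `|z 0 i| <= r.
Proof. by move=> /(_ i) /andP[z0 zr]; rewrite ger0_norm. Qed.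

(* [lambda_star] need not belong to the box, so it has its own bound. *)
Lemma lambda_star_bound : exists2 B : R, r <= B &
  forall x y z i, X x -> Y y -> box p r z -> `|lambda_star x y z 0 i| <= B.
Proof.
have [_ _ hg _ _] := A3; have [M M0 hM] := lipschitz_vec_bound Lg0 hg.
exists (r + gamma2 * M); first by rewrite lerDl mulr_ge0// ltW.
move=> x y z i Xx Yy bz.
have : `|lambda_star x y z 0 i| <= `|(z + gamma2 *: g (row_mx x y)) 0 i|.
  rewrite mxE; case: (leP 0 ((z + gamma2 *: g (row_mx x y)) 0 i)) => // _.
  by rewrite normr0.
move=> /le_trans; apply; rewrite !mxE (le_trans (ler_normD _ _))//.
have h1 := box_abs i bz; have h2 := hM _ (row_mx_setprod Xx Yy).
have h3 := le_trans (abs_le_enorm _ i) h2.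
by rewrite lerD// normrM gtr0_norm// ler_wpM2l// ltW.
Qed.

Lemma is_proj_orthant (u : 'rV[R]_p) :
  is_proj (orthant p) u (\row_i Num.max 0 (u 0 i)).
Proof.
split=> [i|l l0]; first by rewrite mxE le_max lexx.
apply: enorm_le; apply: ler_sum => i _; have := l0 i; rewrite !mxE.
case: (leP 0 (u 0 i)) => u0 li; first by rewrite subrr mul0r -expr2 sqr_ge0.
by rewrite subr0; have := mulr_ge0 li (ltW (_ : 0 < - u 0 i)); rewrite oppr_gt0; nra.
Qed.

Lemma cvx_orthant : cvx (orthant p : set 'rV[R]_p).
Proof.
move=> u v t u0 v0 /andP[t0 t1] i; have := u0 i; have := v0 i; rewrite !mxE.
nra.
Qed.

(** The multiplier computed by the algorithm is therefore exact, and the search direction errs only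
    through [theta]. *)
Lemma lambda_star_unique x y z lambda :
  is_proj (orthant p) (z + gamma2 *: g (row_mx x y)) lambda ->
  lambda = lambda_star x y z.
Proof.
move=> pl; apply/eqP; rewrite -subr_eq0; apply/eqP/enorm0_eq0/eqP.
rewrite eq_le enorm_ge0 andbT.
have := proj_nonexpansive cvx_orthant pl (is_proj_orthant (z + gamma2 *: g (row_mx x y))).
by rewrite subrr enorm0.
Qed.

Lemma lambda_star_lipschitz : exists2 C : R, 0 <= C &
  forall x x' y y' z z', X x -> Y y -> X x' -> Y y' ->
  enorm (lambda_star x y z - lambda_star x' y' z') <=
    C * enorm (row3 x y z - row3 x' y' z').
Proof.
have [_ _ hg _ _] := A3.
exists (1 + gamma2 * Lg); first by rewrite addr_ge0// mulr_ge0// ltW.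
move=> x x' y y' z z' Xx Yy Xx' Yy'.
have := proj_nonexpansive cvx_orthant (is_proj_orthant (z + gamma2 *: g (row_mx x y)))
  (is_proj_orthant (z' + gamma2 *: g (row_mx x' y'))).
move/le_trans; apply; rewrite opprD addrACA -scalerBr.
apply: le_trans (enormD _ _) _; rewrite enormZ gtr0_norm// mulrDl mul1r.
have h := hg _ _ (row_mx_setprod Xx Yy) (row_mx_setprod Xx' Yy').
have [h2 _ _ h1] := enorm_row3_bounds x x' y y' z z'.
rewrite lerD// -mulrA; apply: ler_wpM2l; first exact: ltW.
exact: le_trans h (ler_wpM2l Lg0 h2).
Qed.

(** Serves twice: between two points, for the Lipschitz gradient, and at one point with two values
    of [theta], for the direction error. As [r <= B], the bound [B] covers both [z] and [lambda]. *)
Lemma gap_dir_lipschitz (B : R) : r <= B -> exists2 C : R, 0 <= C &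
  forall x x' y y' z z' theta theta' lambda lambda',
  X x -> X x' -> Y y -> Y y' -> box p r z -> Y theta -> Y theta' ->
  (forall i, `|lambda 0 i| <= B) ->
  enorm (gap_dir x y z theta lambda - gap_dir x' y' z' theta' lambda') <=
  C * (enorm (row3 x y z - row3 x' y' z') + enorm (theta - theta')
       + enorm (lambda - lambda')).
Proof.
move=> rB; have B0 : 0 <= B by exact: le_trans rB.
have [C C0 hC] := grad_lagr_lipschitz B0; have [_ _ hg _ _] := A3.
(* The difference at [(x, y)] is used in two blocks, contributing [2 C N], and the one at
   [(x, theta)] contributes another [2 C N]. *)
exists (4 * C + gamma1^-1 + gamma2^-1 + Lg).
  by rewrite !addr_ge0 ?mulr_ge0 ?invr_ge0 ?(ltW gamma1_gt0) ?(ltW gamma2_gt0).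
move=> x x' y y' z z' t t' l l' Xx Xx' Yy Yy' bz Yt Yt' lB.
have zB i : `|z 0 i| <= B by exact: le_trans (box_abs i bz) rB.
set N := enorm (row3 x y z - row3 x' y' z').
have XY := row_mx_setprod Xx Yy; have XY' := row_mx_setprod Xx' Yy'.
have Xt := row_mx_setprod Xx Yt; have Xt' := row_mx_setprod Xx' Yt'.
have k1 := hC l l' _ _ lB XY XY'; have k2 := hC z z' _ _ zB Xt Xt'.
have k3 := hg _ _ Xt Xt'.
have [Nxy Nx Ny Nz] := enorm_row3_bounds x x' y y' z z'; rewrite -/N in Nxy Nx Ny Nz.
have Nxt : enorm (row_mx x t - row_mx x' t') <= N + enorm (t - t').
  by rewrite row_mxB; apply: le_trans (enorm_row _ _) _; rewrite lerD2r.
rewrite /gap_dir; move: k1 k2 k3.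
move: (glagr l (row_mx x y)) (glagr l' (row_mx x' y')) (glagr z (row_mx x t))
  (glagr z' (row_mx x' t')) (g (row_mx x t)) (g (row_mx x' t')) => G1 G1' G2 G2' g1 g1' k1 k2 k3.
rewrite /row3 !row_mxB.
apply: le_trans (enorm_row _ _) _.
apply: le_trans (lerD (enorm_row _ _) (lexx _)) _.
have e1 : enorm (lsubmx G1 - lsubmx G2 - (lsubmx G1' - lsubmx G2')) <=
    enorm (G1 - G1') + enorm (G2 - G2').
  rewrite opprD addrACA -opprD -!lsubmxB; apply: le_trans (enorm_lsub _) _.
  by apply: le_trans (enormD _ _) _; rewrite enormN.
have e2 : enorm (rsubmx G1 - gamma1^-1 *: (y - t) - (rsubmx G1' - gamma1^-1 *: (y' - t')))
    <= enorm (G1 - G1') + gamma1^-1 * (enorm (y - y') + enorm (t - t')).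
  rewrite opprD addrACA -opprD -scalerBr -rsubmxB; apply: le_trans (enormD _ _) _.
  rewrite enormN enormZ gtr0_norm ?invr_gt0// lerD ?enorm_rsub//.
  apply: ler_wpM2l; first by rewrite invr_ge0 ltW.
  by rewrite opprD addrACA -opprD; apply: le_trans (enormD _ _) _; rewrite enormN.
have e3 : enorm (- (gamma2^-1 *: (z - l)) - g1 - (- (gamma2^-1 *: (z' - l')) - g1')) <=
    gamma2^-1 * (enorm (z - z') + enorm (l - l')) + enorm (g1 - g1').
  have -> : - (gamma2^-1 *: (z - l)) - g1 - (- (gamma2^-1 *: (z' - l')) - g1') =
      - (gamma2^-1 *: ((z - z') - (l - l'))) - (g1 - g1').
    by apply/rowP => i; rewrite !mxE; ring.
  apply: le_trans (enormD _ _) _; rewrite !enormN enormZ gtr0_norm ?invr_gt0// lerD2r.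
  apply: ler_wpM2l; first by rewrite invr_ge0 ltW.
  by apply: le_trans (enormD _ _) _; rewrite enormN.
set a3 := enorm (- _ - _ - _) in e3 *.
have i1 : 0 <= gamma1^-1 by rewrite invr_ge0 ltW.
have i2 : 0 <= gamma2^-1 by rewrite invr_ge0 ltW.
have t0 := enorm_ge0 (t - t'); have l0 := enorm_ge0 (l - l').
have N0 : 0 <= N by exact: enorm_ge0.
have {}k1 := le_trans k1 (ler_wpM2l C0 (lerD Nxy (lexx (enorm (l - l'))))).
have {}k2 := le_trans k2 (ler_wpM2l C0 (lerD Nxt Nz)).
have {}k3 := le_trans k3 (ler_wpM2l Lg0 Nxt).
have {}e2 := le_trans e2 (lerD (lexx _) (ler_wpM2l i1 (lerD Ny (lexx _)))).
have {}e3 := le_trans e3 (lerD (ler_wpM2l i2 (lerD Nz (lexx _))) (lexx _)).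
have m1 := mulr_ge0 C0 t0; have m2 := mulr_ge0 C0 l0; have m3 := mulr_ge0 i1 l0.
have m4 := mulr_ge0 i2 t0; have m5 := mulr_ge0 Lg0 l0.
move: e1 e2 e3 k1 k2 k3 m1 m2 m3 m4 m5.
move: (enorm (lsubmx G1 - _ - _)) (enorm (rsubmx G1 - _ - _)) => a1 a2.
move: (enorm (t - t')) (enorm (l - l')) (enorm (G1 - _)) (enorm (G2 - _)) (enorm (g1 - _))
  (gamma1^-1) (gamma2^-1) => T Lm b1 b2 b3 c1 c2 e1 e2 e3 k1 k2 k3 m1 m2 m3 m4 m5.
lra.
Qed.
End LipschitzData.

(** * The minimization over [theta] and its solution map *)

Section InnerProblem.
Variables (R : realType) (n m p : nat) (X : set 'rV[R]_n) (Y : set 'rV[R]_m).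
Variables (f : 'rV[R]_(n + m) -> R) (g : 'rV[R]_(n + m) -> 'rV[R]_p).
Variables (r Lf Lg Lg1 Lg2 gamma1 : R).
Hypothesis r_ge0 : 0 <= r.
Hypothesis gamma1_gt0 : 0 < gamma1.
Hypothesis cvxY : cvx Y.
Hypothesis cX : compact X.
Hypothesis cY : compact Y.
Hypothesis A2 : assumptionA2 X Y f Lf.
Hypothesis A3 : assumptionA3 X Y g Lg Lg1 Lg2.
Implicit Types (x a : 'rV[R]_n) (y b theta : 'rV[R]_m) (z d lambda : 'rV[R]_p).
Implicit Types (w : 'rV[R]_(n + m)).

Local Notation D := (setprod_row X Y).
Local Notation inner := (inner f g gamma1).
Local Notation grad_inner := (grad_inner f g gamma1).
Local Notation lagr := (lagr f g).
Local Notation glagr := (grad_lagr f g).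

Let fC1 : C1_around D f. Proof. by have [] := A2. Qed.
Let gC1 : C1_around D g. Proof. by have [] := A3. Qed.

Lemma convex_function_segment (h : 'rV[R]_m -> R) u v (t : R) :
  convex_function Y h -> Y u -> Y v -> 0 <= t <= 1 ->
  h (u + t *: (v - u)) <= h u + t * (h v - h u).
Proof.
move=> hc Yu Yv /andP[t0 t1].
have := hc (Itv01 t0 t1) v u; rewrite !inE => /(_ Yv Yu).
have -> : u + t *: (v - u) =
    conv (Itv01 t0 t1) (v : convex_lmodType 'rV[R]_m) u.
  rewrite /conv/= scalerBr scalerBl scale1r.
  by rewrite addrCA addrC -!addrA.
move/le_trans; apply.
change (t * h v + (1 - t) * h u <= h u + t * (h v - h u)); lra.
Qed.

Section FixedPoint.
Variables (x : 'rV[R]_n) (z : 'rV[R]_p).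
Hypothesis Xx : X x.
Hypothesis bz : box p r z.

Let diff_f theta : Y theta -> differentiable f (row_mx x theta).
Proof. by move=> Yt; exact: nbhs_singleton (C1_around_near fC1 (row_mx_setprod Xx Yt)).1. Qed.

Let diff_g theta : Y theta -> differentiable g (row_mx x theta).
Proof. by move=> Yt; exact: nbhs_singleton (C1_around_near gC1 (row_mx_setprod Xx Yt)).1. Qed.

(** Only the [y] block of the Jacobian varies, against multipliers at most [r]; adding [1 / gamma1]
    gives the constant in the bound on [eta]. *)
Lemma grad_lagr_y_lipschitz :
  lipschitz_vec Y (Lf + r * Lg2) (fun u => rsubmx (glagr z (row_mx x u))).
Proof.
move=> u v Yu Yv; have Du := row_mx_setprod Xx Yu; have Dv := row_mx_setprod Xx Yv.
have [_ _ _ hf] := A2; have [_ _ _ _ [_ hg]] := A3.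
have h1 := hf _ _ Du Dv; have h2 := hg _ _ Du Dv.
rewrite row_mxB (subrr x) enorm_row0l in h1 h2.
rewrite /jac_y !hsubmxK in h2; rewrite /grad_lagr.
move: (jac g (row_mx x u)) (jac g (row_mx x v)) (grad f (row_mx x u))
  (grad f (row_mx x v)) h1 h2 => J J' G G' h1 h2.
rewrite -rsubmxB.
have -> : rsubmx (G + z *m J - (G' + z *m J')) =
    rsubmx (G - G') + z *m (rsubmx J - rsubmx J').
  rewrite -rsubmxB -rsub_mulmx mulmxBr opprD addrACA.
  by apply/rowP => i; rewrite !mxE.
apply: le_trans (enormD _ _) _; rewrite mulrDl lerD//.
  exact: le_trans (enorm_rsub _) h1.
rewrite -mulrA; apply: le_trans (enorm_mulmx _ r_ge0 (fun i => box_abs i bz)) _.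
exact: ler_wpM2l.
Qed.

Lemma grad_inner_lipschitz y :
  lipschitz_vec Y (Lf + r * Lg2 + gamma1^-1) (grad_inner x y z).
Proof.
move=> u v Yu Yv; have h := grad_lagr_y_lipschitz Yu Yv.
rewrite /grad_inner opprD addrACA -scalerBr opprB addrA subrK.
apply: le_trans (enormD _ _) _.
by rewrite mulrDl enormZ gtr0_norm ?invr_gt0// lerD2r.
Qed.

Lemma lagr_y_convex u v (t : R) : Y u -> Y v -> 0 <= t <= 1 ->
  lagr z (row_mx x (u + t *: (v - u))) <=
  lagr z (row_mx x u) + t * (lagr z (row_mx x v) - lagr z (row_mx x u)).
Proof.
move=> Yu Yv t01; have [_ hf _ _] := A2; have [_ hg _ _ _] := A3.
have h1 := convex_function_segment (hf _ Xx) Yu Yv t01.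
have h2 : dot z (g (row_mx x (u + t *: (v - u)))) <=
    dot z (g (row_mx x u)) + t * (dot z (g (row_mx x v)) - dot z (g (row_mx x u))).
  rewrite -dotBr -dotZr -dotDr; apply: ler_sum => i _.
  have /andP[z0 _] := bz i; apply: ler_wpM2l => //; rewrite !mxE.
  exact: (convex_function_segment (hg _ Xx i)).
rewrite /lagr; move: h1 h2; set a := f _; set b := dot _ _; lra.
Qed.

Lemma inner_strongly_convex y u v : Y u -> Y v ->
  inner x y z u + dot (grad_inner x y z u) (v - u)
    + gamma1^-1 / 2 * enorm (v - u) ^+ 2 <= inner x y z v.
Proof.
move=> Yu Yv.
have := @convex_gradient_le R m Y (fun u => lagr z (row_mx x u))
  (fun u => rsubmx (glagr z (row_mx x u))) _ cvxY _ grad_lagr_y_lipschitz u v Yu Yv.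
have hd (s e : 'rV[R]_m) : Y s -> is_derive s e (fun u => lagr z (row_mx x u))
    (dot (rsubmx (glagr z (row_mx x s))) e).
  by move=> Ys; apply: is_derive_lagr_y; [exact: diff_f|exact: diff_g].
move=> /(_ hd (fun t => lagr_y_convex Yu Yv)).
rewrite /inner /grad_inner dotDl dotZl.
have -> : enorm (v - y) ^+ 2 = enorm (u - y) ^+ 2 + 2 * dot (u - y) (v - u)
    + enorm (v - u) ^+ 2.
  by rewrite !enorm_sqr !(dotBl, dotBr) (dotC v u) (dotC y v) (dotC y u); ring.
rewrite invfM; lra.
Qed.

Lemma inner_minimizer_exists y : Y !=set0 ->
  exists theta, Y theta /\ forall u, Y u -> inner x y z theta <= inner x y z u.
Proof.
move=> Y0; have [|t Yt ht] := @compact_EVT_min _ R (inner x y z) Y Y0 cY.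
  apply: continuous_in_subspaceT => u uY; have Yu := set_mem uY.
  have rc : {for u, continuous (fun u : 'rV[R]_m => row_mx x u)}.
    exact: (continuous_row_mx (@cst_continuous _ _ x u) (@cvg_id _ (nbhs u))).
  have fc : {for u, continuous (fun u => f (row_mx x u))}.
    by apply: continuous_comp rc _; apply: differentiable_continuous; exact: diff_f.
  have gc : {for u, continuous (fun u => g (row_mx x u))}.
    by apply: continuous_comp rc _; apply: differentiable_continuous; exact: diff_g.
  have cst_cont (V : topologicalType) (c : V) := @cst_continuous 'rV[R]_m V c u.
  have uy : {for u, continuous (fun u : 'rV[R]_m => u - y)}.
    exact: (cvgB (@cvg_id _ (nbhs u)) (cst_cont _ y)).
  have c1 := continuous_dot (cst_cont _ z) gc; have c2 := continuous_dot uy uy.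
  have := cvgD (cvgD fc c1) (cvgM (cst_cont _ (2 * gamma1)^-1) c2).
  rewrite (_ : inner x y z = fun u => f (row_mx x u) + dot z (g (row_mx x u)) +
    (2 * gamma1)^-1 * dot (u - y) (u - y)); first exact.
  by apply/funext => v; rewrite /inner enorm_sqr.
exists t; split; first exact: set_mem Yt.
by move=> u Yu; apply: ht; exact/mem_set.
Qed.

End FixedPoint.

(** The default 0 is never reached for [x] in [X], as [Y] is compact and nonempty; for [z] in the
    box, strong convexity makes the choice unique. *)
Definition theta_star x y z : 'rV[R]_m :=
  xget 0 [set t | Y t /\ forall u, Y u -> inner x y z t <= inner x y z u].

Section ThetaStar.
Hypothesis Y0 : Y !=set0.

Lemma theta_star_min x y z : X x -> Y (theta_star x y z) /\
  forall u, Y u -> inner x y z (theta_star x y z) <= inner x y z u.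
Proof.
move=> Xx; have [t ht] := inner_minimizer_exists z Xx y Y0.
exact: (@xgetI _ 0 [set t | Y t /\ forall u, Y u -> inner x y z t <= inner x y z u] t ht).
Qed.

Lemma theta_star_in x y z : X x -> Y (theta_star x y z).
Proof.
by move=> Xx; have [] := theta_star_min y z Xx.
Qed.

Lemma theta_star_vi x y z u : X x -> box p r z -> Y u ->
  0 <= dot (grad_inner x y z (theta_star x y z)) (u - theta_star x y z).
Proof.
move=> Xx bz Yu; have Yt := theta_star_in y z Xx.
apply: (minimizer_vi cvxY _ (grad_inner_lipschitz Xx bz y) Yt Yu).
  move=> w v Yw; apply: is_derive_inner => //.
    exact: nbhs_singleton (C1_around_near fC1 (row_mx_setprod Xx Yw)).1.
  exact: nbhs_singleton (C1_around_near gC1 (row_mx_setprod Xx Yw)).1.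
by have [] := theta_star_min y z Xx.
Qed.

(** At the minimizer the first-order term is nonnegative, so strong convexity becomes quadratic
    growth. The strict minimality that Danskin's theorem asks for follows. *)
Lemma theta_star_growth x y z u : X x -> box p r z -> Y u ->
  inner x y z (theta_star x y z)
    + gamma1^-1 / 2 * enorm (u - theta_star x y z) ^+ 2 <= inner x y z u.
Proof.
move=> Xx bz Yu; have Yt := theta_star_in y z Xx.
apply: le_trans (inner_strongly_convex Xx bz y Yt Yu).
by rewrite lerD2r lerDl theta_star_vi.
Qed.

Lemma theta_star_strict x y z u : X x -> box p r z -> Y u ->
  u <> theta_star x y z -> inner x y z (theta_star x y z) < inner x y z u.
Proof.
move=> Xx bz Yu ut; apply: lt_le_trans (theta_star_growth y Xx bz Yu).
rewrite ltrDl mulr_gt0 ?divr_gt0 ?invr_gt0// exprn_gt0// lt_def enorm_ge0 andbT.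
by apply/eqP => /enorm0_eq0/eqP; rewrite subr_eq0 => /eqP.
Qed.

Lemma theta_step_contraction x y z eta theta theta' : X x -> box p r z ->
  Y theta -> 0 < eta -> eta * (Lf + r * Lg2 + gamma1^-1) <= 1 ->
  is_proj Y (theta - eta *: grad_inner x y z theta) theta' ->
  enorm (theta' - theta_star x y z) ^+ 2 <=
    (1 - eta / gamma1) * enorm (theta - theta_star x y z) ^+ 2.
Proof.
move=> Xx bz Yt eta0 etaL; have mu0 : 0 <= gamma1^-1 by rewrite invr_ge0 ltW.
apply: (proj_gradient_contraction cvxY _ (grad_inner_lipschitz Xx bz y) mu0 eta0 etaL Yt) => //.
- move=> w v Yw; apply: is_derive_inner => //.
    exact: nbhs_singleton (C1_around_near fC1 (row_mx_setprod Xx Yw)).1.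
  exact: nbhs_singleton (C1_around_near gC1 (row_mx_setprod Xx Yw)).1.
- exact: theta_star_in.
- by move=> v Yv; exact: theta_star_growth.
- by move=> v Yv; exact: inner_strongly_convex.
Qed.

(** Strong convexity at [t'], growth at [t] and optimality of [t'] for the second problem add up to
    [|t - t'|^2 / gamma1 <= dot (G' - G) (t - t')], where [G] and [G'] are the gradients of both
    problems at the same point [t']. *)
Lemma theta_star_lipschitz : exists2 C : R, 0 <= C &
  forall x x' y y' z z', X x -> X x' -> box p r z -> box p r z' ->
  enorm (theta_star x y z - theta_star x' y' z') <=
    C * enorm (row3 x y z - row3 x' y' z').
Proof.
have [C C0 hC] := grad_lagr_lipschitz cX cY A2 A3 r_ge0.
exists (gamma1 * (2 * C + gamma1^-1)).
  by rewrite !(mulr_ge0, addr_ge0) ?invr_ge0 ?(ltW gamma1_gt0).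
move=> x x' y y' z z' Xx Xx' bz bz'.
set t := theta_star x y z; set t' := theta_star x' y' z'.
have Yt : Y t := theta_star_in y z Xx; have Yt' : Y t' := theta_star_in y' z' Xx'.
set N := enorm (row3 x y z - row3 x' y' z').
have [_ Nx Ny Nz] := enorm_row3_bounds x x' y y' z z'; rewrite -/N in Nx Ny Nz.
have k := hC z z' _ _ (fun i => box_abs i bz) (row_mx_setprod Xx Yt') (row_mx_setprod Xx' Yt').
have eW : enorm (row_mx x t' - row_mx x' t') = enorm (x - x').
  by rewrite row_mxB subrr enorm_row0r.
rewrite eW in k.
have e : enorm (grad_inner x y z t' - grad_inner x' y' z' t') <= (2 * C + gamma1^-1) * N.
  rewrite /grad_inner; move: (glagr z _) (glagr z' _) k => G G' k.
  rewrite opprD addrACA -rsubmxB -scalerBr.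
  have -> : t' - y - (t' - y') = y' - y by apply/rowP => i; rewrite !mxE; ring.
  apply: le_trans (enormD _ _) _; rewrite enormZ gtr0_norm ?invr_gt0//.
  have k1 := le_trans (le_trans (enorm_rsub _) k) (ler_wpM2l C0 (lerD Nx Nz)).
  have i1 : 0 <= gamma1^-1 by rewrite invr_ge0 ltW.
  have := ler_wpM2l i1 Ny; rewrite (enormB y); lra.
have s1 := inner_strongly_convex Xx bz y Yt' Yt.
have s2 := theta_star_growth y Xx bz Yt'; rewrite -/t in s2.
have s3 := theta_star_vi y' Xx' bz' Yt; rewrite -/t' in s3.
have s4 := cauchy_schwarz (grad_inner x' y' z' t' - grad_inner x y z t') (t - t').
rewrite dotBl enormB in s4; rewrite (enormB t' t) in s2.
have s5 : gamma1^-1 * enorm (t - t') ^+ 2 <= (2 * C + gamma1^-1) * N * enorm (t - t').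
  have s6 := ler_wpM2r (enorm_ge0 (t - t')) e; move: s1 s2 s3 s4 s6.
  move: (enorm (t - t')) (enorm (grad_inner _ _ _ _ - _)) (inner x y z t) (inner x y z t')
    (dot (grad_inner x' y' z' t') _) (dot (grad_inner x y z t') _) => a1 a2 b1 b2 a3 a4; lra.
have [->|n0] := eqVneq (enorm (t - t')) 0.
  by rewrite !mulr_ge0 ?addr_ge0 ?mulr_ge0 ?invr_ge0 ?(ltW gamma1_gt0) ?enorm_ge0.
have tt0 : 0 < enorm (t - t') by rewrite lt_def n0 enorm_ge0.
rewrite -mulrA -ler_pdivrMl//.
by move: s5; rewrite expr2 mulrA ler_pM2r.
Qed.

End ThetaStar.
End InnerProblem.

(** * Rates from a descent inequality *)

Section Rates.
Variable R : realType.

Lemma sum_le_of_descent (V S : nat -> R) : (forall k, 0 <= V k) ->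
  (forall k, V k.+1 + S k <= V k) -> forall K, \sum_(k < K) S k <= V 0%N.
Proof.
move=> V0 VS K; apply: le_trans (_ : V 0%N - V K <= _); last first.
  by rewrite lerBlDr lerDl.
elim: K => [|K IH]; first by rewrite big_ord0 subrr.
by rewrite big_ord_recr /=; have := VS K; lra.
Qed.

(** Young's inequality with weight [kappa / 2] on [(E + Lt D)^2] keeps half of the contraction. That
    half, times [Ce], equals [Cd^2 / 2 + 1]: the first part pays for [Cd E D], the second leaves
    [e^2]. In the threshold for [a], [3 / 2] is [1 / 2] for the same product plus 1 for the [D^2]
    kept, and the last term pays for the drift. *)
Lemma lyapunov_step (phi phi' D E e e' a L Cd Lt kappa : R) :
  0 <= D -> 0 <= E -> 0 <= e' -> 0 <= Lt -> 0 < kappa ->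
  phi' <= phi - (a - L / 2) * D ^+ 2 + Cd * E * D ->
  E ^+ 2 <= (1 - kappa) * e ^+ 2 -> e' <= E + Lt * D ->
  let Ce := (Cd ^+ 2 + 2) / kappa in
  L / 2 + 3 / 2 + Ce * (1 + 2 / kappa) * Lt ^+ 2 <= a ->
  phi' + Ce * e' ^+ 2 + (D ^+ 2 + e ^+ 2) <= phi + Ce * e ^+ 2.
Proof.
move=> D0 E0 e'0 Lt0 k0 hphi hE he' Ce ha.
have Ce0 : 0 <= Ce by rewrite divr_ge0 ?(ltW k0)// addr_ge0// sqr_ge0.
have CeE : Ce * (kappa / 2) = Cd ^+ 2 / 2 + 1.
  by rewrite /Ce; field; rewrite gt_eqF.
have d2 := sqr_ge0 D; have e2 := sqr_ge0 e.
have h1 : e' ^+ 2 <= (1 + kappa / 2) * E ^+ 2 + (1 + 2 / kappa) * (Lt ^+ 2 * D ^+ 2).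
  have h : e' ^+ 2 <= (E + Lt * D) ^+ 2.
    by rewrite ler_pXn2r// nnegrE addr_ge0// mulr_ge0.
  apply: le_trans h _; rewrite -subr_ge0.
  rewrite (_ : _ - _ = (kappa / 2) * (E - 2 / kappa * (Lt * D)) ^+ 2).
    by rewrite mulr_ge0 ?sqr_ge0// divr_ge0// ltW.
  by field; rewrite gt_eqF.
have h2 : (1 + kappa / 2) * E ^+ 2 <= (1 - kappa / 2) * e ^+ 2.
  have k1 : 0 <= 1 + kappa / 2 by rewrite addr_ge0// divr_ge0// ltW.
  have := ler_wpM2l k1 hE; have := mulr_ge0 (sqr_ge0 kappa) e2; lra.
have h3 : Cd * E * D <= D ^+ 2 / 2 + Cd ^+ 2 / 2 * e ^+ 2.
  have h : E ^+ 2 <= e ^+ 2 by have := mulr_ge0 (ltW k0) e2; lra.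
  have := ler_wpM2l (sqr_ge0 Cd) h; have := sqr_ge0 (D - Cd * E); lra.
have h4 := ler_wpM2l Ce0 (le_trans h1 (lerD h2 (lexx _))).
have h5 := ler_wpM2r d2 ha.
have h6 : Ce * ((1 - kappa / 2) * e ^+ 2) = Ce * e ^+ 2 - (Cd ^+ 2 / 2 + 1) * e ^+ 2.
  by rewrite -CeE; ring.
rewrite mulrDr h6 in h4.
move: Ce0 CeE ha h4 h5 {h6} => _ _ _ h4 h5.
lra.
Qed.

(** The exponents [2 rho] and [1 - 2 rho] add up to 1, so the growth of [c_K^2] and the claimed rate
    together cancel the [K + 1] of the average. *)
Lemma powR_split (rho : R) (K : nat) : 0 <= rho < 1 / 2 ->
  (K.+1%:R `^ rho) ^+ 2 * (K%:R `^ ((1 - 2 * rho) / 2)) ^+ 2 <= K.+1%:R.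
Proof.
move=> /andP[r0 r1].
have s0 : 0 <= (1 - 2 * rho) / 2 by lra.
have h : K%:R `^ ((1 - 2 * rho) / 2) <= K.+1%:R `^ ((1 - 2 * rho) / 2).
  by apply: ge0_ler_powR; rewrite ?nnegrE// ler_nat.
rewrite -exprMn.
apply: (@le_trans _ _ ((K.+1%:R `^ rho * K.+1%:R `^ ((1 - 2 * rho) / 2)) ^+ 2)).
  rewrite ler_pXn2r ?nnegrE ?mulr_ge0 ?powR_ge0//.
  by rewrite ler_wpM2l ?powR_ge0.
rewrite -powRD ?pnatr_eq0 ?implybT// -powR_mulrn ?powR_ge0// -powRrM.
rewrite (_ : (rho + (1 - 2 * rho) / 2) * 2%:R = 1) ?powRr1//.
lra.
Qed.

(** The squared minimum is at most each of the [K + 1] squared residuals, hence at most their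
    average, and [c k <= c K] takes the penalty out of the sum. *)
Lemma min_rate (c0 rho C M : R) (c D e Rk : nat -> R) :
  0 < c0 -> 0 <= rho < 1 / 2 -> 0 <= C ->
  (forall k, c k = c0 * (k.+1%:R `^ rho)) ->
  (forall k, 0 <= D k) -> (forall k, 0 <= e k) -> (forall k, 0 <= Rk k) ->
  (forall k, Rk k <= c k * (C * (D k + e k))) ->
  (forall K, \sum_(k < K) (D k ^+ 2 + e k ^+ 2) <= M) ->
  ((fun K : nat => \big[Num.min/Rk 0%N]_(k < K.+1) Rk k) : nat -> R)
    =O_\oo (fun K : nat => 1 / (K%:R `^ ((1 - 2 * rho) / 2))).
Proof.
move=> c00 rho01 C0 cE D0 e0 R0 Rle sumM; have /andP[r0 r1] := rho01.
have M0 : 0 <= M by have := sumM 0%N; rewrite big_ord0.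
pose B := 2 * c0 ^+ 2 * C ^+ 2 * M.
have B0 : 0 <= B.
  apply: mulr_ge0 M0; apply: mulr_ge0 (sqr_ge0 _).
  by apply: mulr_ge0 (sqr_ge0 _).
(* [B] may be 0 while the constant must be positive; moreover [1 + B] dominates the square root of
   [B]. *)
apply/eqO_exP; exists (1 + B); first by rewrite ltr_pwDl.
near=> K.
have K0 : (0 < K)%N by near: K; exact: nbhs_infty_gt.
set m := \big[Num.min/_]_(_ < _) _; set Q := K%:R `^ _.
have Q0 : 0 < Q by apply: powR_gt0; rewrite ltr0n.
have m0 : 0 <= m by rewrite /m; elim/big_ind : _ => // a b a0 b0; rewrite le_min a0.
have mle (k : 'I_K.+1) : m <= Rk k by exact: bigmin_le_cond.
rewrite ger0_norm// ger0_norm ?divr_ge0 ?(ltW Q0)// mul1r.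
rewrite ler_pdivlMr//.
have P0 : 0 <= K.+1%:R `^ rho by exact: powR_ge0.
have cle (k : 'I_K.+1) : c k <= c K.
  rewrite !cE ler_wpM2l ?(ltW c00)//.
  by apply: ge0_ler_powR; rewrite ?nnegrE// ler_nat ltn_ord.
have ck0 k : 0 <= c k by rewrite cE mulr_ge0 ?powR_ge0// ltW.
have hk (k : 'I_K.+1) : m ^+ 2 <= 2 * c K ^+ 2 * C ^+ 2 * (D k ^+ 2 + e k ^+ 2).
  have De0 : 0 <= D k + e k by exact: addr_ge0.
  have h : m <= c K * (C * (D k + e k)).
    apply: le_trans (mle k) _; apply: le_trans (Rle k) _.
    by rewrite ler_wpM2r// mulr_ge0.
  have {}h : m ^+ 2 <= (c K * (C * (D k + e k))) ^+ 2.
    by rewrite ler_pXn2r// nnegrE !mulr_ge0.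
  apply: le_trans h _.
  have -> : 2 * c K ^+ 2 * C ^+ 2 * (D k ^+ 2 + e k ^+ 2) =
    c K ^+ 2 * (C ^+ 2 * (2 * (D k ^+ 2 + e k ^+ 2))) by ring.
  rewrite !exprMn.
  apply: ler_wpM2l; first exact: sqr_ge0.
  apply: ler_wpM2l; first exact: sqr_ge0.
  have := sqr_ge0 (D k - e k); lra.
have hs : K.+1%:R * m ^+ 2 <= 2 * c K ^+ 2 * C ^+ 2 * M.
  apply: le_trans (ler_wpM2l _ (sumM K.+1)); last first.
    by apply: mulr_ge0 (sqr_ge0 _); apply: mulr_ge0 (sqr_ge0 _).
  rewrite mulr_sumr mulr_natl -[X in _ *+ X]card_ord -sumr_const.
  by apply: ler_sum => k _; exact: hk.
have hQ : (m * Q) ^+ 2 <= B.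
  rewrite -(@ler_pM2l _ K.+1%:R) ?ltr0n// exprMn mulrA.
  apply: le_trans (ler_wpM2r (sqr_ge0 Q) hs) _.
  have hp := powR_split K rho01; rewrite -/Q in hp.
  rewrite cE (_ : _ * Q ^+ 2 = B * ((K.+1%:R `^ rho) ^+ 2 * Q ^+ 2)); last by rewrite /B; ring.
  by rewrite [leRHS]mulrC; apply: ler_wpM2l.
rewrite -(@ler_pXn2r _ 2)// ?nnegrE ?mulr_ge0 ?(ltW Q0) ?addr_ge0//.
by apply: le_trans hQ _; nra.
Unshelve. all: by end_near. Qed.

Lemma gap_rate (c0 rho M : R) (c G : nat -> R) :
  0 < c0 -> 0 <= rho -> (forall k, c k = c0 * (k.+1%:R `^ rho)) ->
  (forall k, 0 <= G k) -> (forall k, c k * G k <= M) ->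
  (G : nat -> R) =O_\oo (fun K : nat => 1 / (K%:R `^ rho)).
Proof.
move=> c00 r0 cE G0 GM; have M0 : 0 <= M.
  by apply: le_trans (GM 0%N); rewrite cE !mulr_ge0 ?powR_ge0// ltW.
apply/eqO_exP; exists (1 + M / c0); first by rewrite ltr_pwDl// divr_ge0// ltW.
near=> K.
have K0 : (0 < K)%N by near: K; exact: nbhs_infty_gt.
set Q := K%:R `^ _.
have Q0 : 0 < Q by apply: powR_gt0; rewrite ltr0n.
rewrite ger0_norm// ger0_norm ?divr_ge0 ?(ltW Q0)// mul1r ler_pdivlMr//.
have h : Q <= K.+1%:R `^ rho by apply: ge0_ler_powR; rewrite ?nnegrE// ler_nat.
have h1 : G K * Q <= M / c0.
  rewrite ler_pdivlMr//; apply: le_trans (GM K); rewrite cE.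
  have := ler_wpM2r (G0 K) (ler_wpM2l (ltW c00) h); lra.
by apply: le_trans h1 _; rewrite lerDr.
Unshelve. all: by end_near. Qed.

End Rates.

(** * The iteration *)

Section Algorithm.
Variables (R : realType) (n m p : nat) (X : set 'rV[R]_n) (Y : set 'rV[R]_m).
Variables (F f : 'rV[R]_(n + m) -> R) (g : 'rV[R]_(n + m) -> 'rV[R]_p).
Variables (r LF Lf Lg Lg1 Lg2 gamma1 gamma2 c0 : R).
Hypothesis r_ge0 : 0 <= r.
Hypothesis gamma1_gt0 : 0 < gamma1.
Hypothesis gamma2_gt0 : 0 < gamma2.
Hypothesis c0_gt0 : 0 < c0.
Hypothesis cvxX : cvx X.
Hypothesis cvxY : cvx Y.
Hypothesis cX : compact X.
Hypothesis cY : compact Y.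
Hypothesis Y0 : Y !=set0.
Hypothesis A1 : assumptionA1 X Y F LF.
Hypothesis A2 : assumptionA2 X Y f Lf.
Hypothesis A3 : assumptionA3 X Y g Lg Lg1 Lg2.
Implicit Types (x a : 'rV[R]_n) (y b theta : 'rV[R]_m) (z d lambda : 'rV[R]_p).
Implicit Types (w : 'rV[R]_(n + m + p)).

Local Notation XYZ := (@Defs.XYZ R n m p X Y r).
Local Notation gap := (gap Y f g gamma1 gamma2).
Local Notation psi := (psi Y F f g gamma1 gamma2).
Local Notation lambda_star := (lambda_star g gamma2).
Local Notation theta_star := (theta_star Y f g gamma1).
Local Notation gap_dir := (gap_dir f g gamma1 gamma2).

Let fC1 : C1_around (setprod_row X Y) f. Proof. by have [] := A2. Qed.
Let gC1 : C1_around (setprod_row X Y) g. Proof. by have [] := A3. Qed.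

Lemma row3K w : row3 (lsubmx (lsubmx w)) (rsubmx (lsubmx w)) (rsubmx w) = w.
Proof. by rewrite /row3 !hsubmxK. Qed.

Lemma XYZ_row3 x y z : X x -> Y y -> box p r z -> XYZ (row3 x y z).
Proof. by move=> Xx Yy bz; rewrite /Defs.XYZ /setprod_row /row3/= !row_mxKl !row_mxKr. Qed.

Lemma row3_XYZ x y z : XYZ (row3 x y z) -> [/\ X x, Y y & box p r z].
Proof. by rewrite /Defs.XYZ /setprod_row /row3/= !row_mxKl !row_mxKr => -[[]]. Qed.

Lemma cvx_setprod k l (C : set 'rV[R]_k) (E : set 'rV[R]_l) :
  cvx C -> cvx E -> cvx (setprod_row C E).
Proof.
move=> cC cE u v t [Cu Eu] [Cv Ev] t01.
have -> : u + t *: (v - u) = row_mx (lsubmx u + t *: (lsubmx v - lsubmx u))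
    (rsubmx u + t *: (rsubmx v - rsubmx u)).
  rewrite -lsubmxB -rsubmxB; rewrite -{1}(hsubmxK u) -{1}(hsubmxK (v - u)).
  by rewrite scale_row_mx add_row_mx.
by split; rewrite (row_mxKl, row_mxKr); [exact: cC|exact: cE].
Qed.

Lemma cvx_box : cvx (box p r : set 'rV[R]_p).
Proof.
move=> u v t hu hv /andP[t0 t1] i; have := hu i; have := hv i; rewrite !mxE.
by move=> /andP[v0 v1] /andP[u0 u1]; apply/andP; split; nra.
Qed.

Lemma cvx_XYZ : cvx XYZ.
Proof. by apply: cvx_setprod cvx_box; exact: cvx_setprod. Qed.

Definition pot_dir (c : R) x y z theta lambda : 'rV[R]_(n + m + p) :=
  c^-1 *: row_mx (grad F (row_mx x y)) 0 + gap_dir x y z theta lambda.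

Definition grad_pot (c : R) w : 'rV[R]_(n + m + p) :=
  let x := lsubmx (lsubmx w) in let y := rsubmx (lsubmx w) in let z := rsubmx w in
  pot_dir c x y z (theta_star x y z) (lambda_star x y z).

(** The [phi_k] of the overview for [c = c_k], written through [psi] so that its derivative is a
    multiple of the one of [psi]. *)
Definition pot (c : R) w : R :=
  c^-1 * psi c (lsubmx (lsubmx w)) (rsubmx (lsubmx w)) (rsubmx w).

Lemma pot_dirE (c : R) x y z theta lambda :
  row3 (dir_x F f g c x y z theta lambda) (dir_y F f g gamma1 c x y theta lambda)
       (dir_z g gamma2 x z theta lambda) = pot_dir c x y z theta lambda.
Proof.
rewrite /pot_dir /gap_dir /dir_x /dir_y /dir_z /grad_x /grad_y /jac_x /jac_y /grad_lagr.
move: (grad F _) (grad f (row_mx x y)) (grad f (row_mx x theta)) (jac g (row_mx x y))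
  (jac g (row_mx x theta)) (g _) => GF G1 G2 J1 J2 g1.
rewrite /row3 scale_row_mx add_row_mx scaler0 add0r; congr row_mx.
rewrite -{3}(hsubmxK GF) scale_row_mx add_row_mx.
have lD k l1 l2 (u v : 'M[R]_(k, l1 + l2)) : lsubmx (u + v) = lsubmx u + lsubmx v.
  by apply/matrixP => i j; rewrite !mxE.
have rD k l1 l2 (u v : 'M[R]_(k, l1 + l2)) : rsubmx (u + v) = rsubmx u + rsubmx v.
  by apply/matrixP => i j; rewrite !mxE.
rewrite !lD !rD !lsub_mulmx !rsub_mulmx; congr row_mx; last by rewrite !addrA.
by rewrite opprD !addrA.
Qed.

(** The residual is stated with [psi] and the steps are analysed with [pot]; this factor [c] becomes
    the [c_k] in the residual bound. *)
Lemma grad_psi_pot (c : R) x y z : XYZ (row3 x y z) -> 0 < c ->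
  grad_psi Y F f g gamma1 gamma2 c (row3 x y z) = c *: grad_pot c (row3 x y z).
Proof.
move=> /row3_XYZ[Xx Yy bz] cpos; have [_ [dF _] _ _] := A1.
rewrite /grad_pot /pot_dir.
have -> : lsubmx (lsubmx (row3 x y z)) = x by rewrite /row3 !row_mxKl.
have -> : rsubmx (lsubmx (row3 x y z)) = y by rewrite /row3 row_mxKl row_mxKr.
have -> : rsubmx (row3 x y z) = z by rewrite /row3 row_mxKr.
rewrite scalerDr scalerA mulfV ?gt_eqF// scale1r.
exact: (grad_psi_dir gamma1_gt0 gamma2_gt0 fC1 gC1 cY Xx Yy
  (theta_star_in gamma1 cY A2 A3 Y0 y z Xx)
  (fun u Yu => theta_star_strict r_ge0 gamma1_gt0 cvxY cY A2 A3 Y0 Xx bz Yu)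
  c (dF _ (row_mx_setprod Xx Yy))).
Qed.

Lemma is_derive_pot (c : R) w v : XYZ w -> 0 < c ->
  is_derive w v (pot c) (dot (grad_pot c w) v).
Proof.
rewrite -{1 2}(row3K w).
set x := lsubmx (lsubmx w); set y := rsubmx (lsubmx w); set z := rsubmx w.
move=> /row3_XYZ[Xx Yy bz] cpos; have [_ [dF _] _ _] := A1.
have h := is_derive_psi gamma1_gt0 gamma2_gt0 fC1 gC1 cY Xx Yy
  (theta_star_in gamma1 cY A2 A3 Y0 y z Xx)
  (fun u Yu => theta_star_strict r_ge0 gamma1_gt0 cvxY cY A2 A3 Y0 Xx bz Yu)
  c (dF _ (row_mx_setprod Xx Yy)) v.
have := is_deriveZ c^-1 h; congr is_derive.
rewrite /grad_pot -/x -/y -/z /pot_dir -[LHS]dotZl; congr dot.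
by rewrite scalerDr scalerA mulVf ?gt_eqF// scale1r.
Qed.

(** One constant for all penalties: [F] contributes at most [LF / c0], and the gap part does not
    depend on [c]. *)
Lemma grad_pot_lipschitz : exists2 C : R, 0 <= C &
  forall c, c0 <= c -> lipschitz_vec XYZ C (grad_pot c).
Proof.
have [B rB hB] := lambda_star_bound r gamma2_gt0 cX cY A3.
have [C C_ge0 hC] := gap_dir_lipschitz r_ge0 gamma1_gt0 gamma2_gt0 cX cY A2 A3 rB.
have [Cl Cl0 hl] := lambda_star_lipschitz gamma2_gt0 A3.
have [Ct Ct0 ht] := theta_star_lipschitz r_ge0 gamma1_gt0 cvxY cX cY A2 A3 Y0.
have [LF0 _ hF _] := A1.
exists (c0^-1 * LF + C * (1 + Ct + Cl)).
  by rewrite addr_ge0// !mulr_ge0 ?invr_ge0 ?(ltW c0_gt0)// !addr_ge0.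
move=> c c0c w w'; rewrite -(row3K w) -(row3K w').
move: (lsubmx (lsubmx w)) (rsubmx (lsubmx w)) (rsubmx w) => x y z.
move: (lsubmx (lsubmx w')) (rsubmx (lsubmx w')) (rsubmx w') => x' y' z'.
move=> /row3_XYZ[Xx Yy bz] /row3_XYZ[Xx' Yy' bz'].
rewrite /grad_pot /row3 !row_mxKl !row_mxKr -/(row3 x y z) -/(row3 x' y' z').
set N := enorm (row3 x y z - row3 x' y' z').
have Yt := theta_star_in gamma1 cY A2 A3 Y0 y z Xx.
have Yt' := theta_star_in gamma1 cY A2 A3 Y0 y' z' Xx'.
have k1 := hC _ _ _ _ _ z' _ _ (lambda_star x y z) (lambda_star x' y' z')
  Xx Xx' Yy Yy' bz Yt Yt' (fun i => hB _ _ _ i Xx Yy bz).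
have k2 := hl _ _ _ _ z z' Xx Yy Xx' Yy'; have k3 := ht _ _ y y' _ _ Xx Xx' bz bz'.
rewrite -/N in k1 k2 k3.
have k4 : enorm (c^-1 *: row_mx (grad F (row_mx x y)) (0 : 'rV[R]_p)
    - c^-1 *: row_mx (grad F (row_mx x' y')) 0) <= c0^-1 * LF * N.
  rewrite -scalerBr row_mxB subrr enormZ enorm_row0r.
  have cpos : 0 < c by exact: lt_le_trans c0c.
  rewrite gtr0_norm ?invr_gt0// -mulrA.
  apply: ler_pM; rewrite ?invr_ge0 ?enorm_ge0 ?(ltW cpos)//.
    by rewrite lef_pV2.
  have := hF _ _ (row_mx_setprod Xx Yy) (row_mx_setprod Xx' Yy').
  move/le_trans; apply; apply: ler_wpM2l => //.
  by have [] := enorm_row3_bounds x x' y y' z z'.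
rewrite /pot_dir opprD addrACA; apply: le_trans (enormD _ _) _.
rewrite mulrDl; apply: lerD => //; apply: le_trans k1 _.
rewrite -mulrA !mulrDl mul1r; apply: ler_wpM2l => //.
exact: lerD (lerD (lexx _) k3) k2.
Qed.

End Algorithm.

(** * Estimates for one iteration *)

Section Iteration.
Variables (R : realType) (n m p : nat) (X : set 'rV[R]_n) (Y : set 'rV[R]_m).
Variables (F f : 'rV[R]_(n + m) -> R) (g : 'rV[R]_(n + m) -> 'rV[R]_p).
Variables (r LF Lf Lg Lg1 Lg2 gamma1 gamma2 c0 : R).
Hypothesis r_ge0 : 0 <= r.
Hypothesis gamma1_gt0 : 0 < gamma1.
Hypothesis gamma2_gt0 : 0 < gamma2.
Hypothesis c0_gt0 : 0 < c0.
Hypothesis cvxX : cvx X.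
Hypothesis cvxY : cvx Y.
Hypothesis cX : compact X.
Hypothesis cY : compact Y.
Hypothesis Y0 : Y !=set0.
Hypothesis A1 : assumptionA1 X Y F LF.
Hypothesis A2 : assumptionA2 X Y f Lf.
Hypothesis A3 : assumptionA3 X Y g Lg Lg1 Lg2.
Implicit Types (x a : 'rV[R]_n) (y b theta : 'rV[R]_m) (z d lambda : 'rV[R]_p).
Implicit Types (w : 'rV[R]_(n + m + p)).

Local Notation XYZ := (@Defs.XYZ R n m p X Y r).
Local Notation gap := (gap Y f g gamma1 gamma2).
Local Notation lambda_star := (lambda_star g gamma2).
Local Notation theta_star := (theta_star Y f g gamma1).
Local Notation gap_dir := (gap_dir f g gamma1 gamma2).
Local Notation pot := (pot Y F f g gamma1 gamma2).
Local Notation grad_pot := (grad_pot Y F f g gamma1 gamma2).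
Local Notation pot_dir := (pot_dir F f g gamma1 gamma2).

(** The choice [lambda = z], [theta = y] is admissible and gives the value 0. *)
Lemma gap_ge0 x y z : X x -> Y y -> box p r z -> 0 <= gap x y z.
Proof.
move=> Xx Yy bz; have [Yt tmin] := theta_star_min gamma1 cY A2 A3 Y0 y z Xx.
have lb : lbound [set inner f g gamma1 x y z u | u in Y]
    (inner f g gamma1 x y z (theta_star x y z)).
  by move=> _ [u Yu <-]; exact: tmin.
rewrite (gapE gamma2_gt0 Y0); last by exists (inner f g gamma1 x y z (theta_star x y z)).
have z0 : orthant p z by move=> i; have /andP[] := bz i.
rewrite subr_ge0; apply: le_trans (gap_upper_ge f g gamma2_gt0 x y z z0).
rewrite subrr enorm0 expr0n mulr0 subr0.
apply: (@le_trans _ _ (inner f g gamma1 x y z y)).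
  by apply: ge_inf; [exists (inner f g gamma1 x y z (theta_star x y z))|exists y].
by rewrite /inner subrr enorm0 expr0n mulr0 addr0.
Qed.

Lemma pot_row3 (c : R) x y z : 0 < c ->
  pot c (row3 x y z) = c^-1 * F (row_mx x y) + gap x y z.
Proof.
move=> cpos; rewrite /pot /row3 !row_mxKl !row_mxKr /Defs.psi mulrDr mulrA.
by rewrite mulVf ?mul1r// gt_eqF.
Qed.

Lemma dir_thetaE x y z theta :
  dir_theta f g gamma1 x y z theta = grad_inner f g gamma1 x y z theta.
Proof.
rewrite /dir_theta /grad_inner /grad_lagr /grad_y /jac_y -rsub_mulmx; congr (_ + _).
move: (grad f _) (z *m _) => G J.
by apply/rowP => i; rewrite !mxE.
Qed.

(** The constants are fixed before the penalty, the stepsizes and the iterates, so [c_alpha] can be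
    computed from them. *)
Lemma iteration_bounds : exists L Cd Lt : R, [/\ 0 <= L, 0 <= Cd & 0 <= Lt] /\
  forall c eta alpha x y z theta lambda x' y' z' theta',
  c0 <= c -> 0 < alpha -> 0 < eta -> eta * (Lf + r * Lg2 + gamma1^-1) <= 1 ->
  X x -> Y y -> box p r z -> Y theta ->
  is_proj Y (theta - eta *: dir_theta f g gamma1 x y z theta) theta' ->
  is_proj (orthant p) (z + gamma2 *: g (row_mx x y)) lambda ->
  is_proj XYZ (row3 x y z - alpha *:
    row3 (dir_x F f g c x y z theta' lambda) (dir_y F f g gamma1 c x y theta' lambda)
         (dir_z g gamma2 x z theta' lambda)) (row3 x' y' z') ->
  let D := enorm (row3 x' y' z' - row3 x y z) in
  let E := enorm (theta' - theta_star x y z) in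
  [/\ pot c (row3 x' y' z') <=
        pot c (row3 x y z) - (alpha^-1 - L / 2) * D ^+ 2 + Cd * E * D,
      E ^+ 2 <= (1 - eta / gamma1) * enorm (theta - theta_star x y z) ^+ 2,
      enorm (theta' - theta_star x' y' z') <= E + Lt * D
    & 0 <= residual X Y r F f g gamma1 gamma2 c x' y' z'
        <= c * ((L + alpha^-1) * D + Cd * E)].
Proof.
have [L L0 hL] := grad_pot_lipschitz r_ge0 gamma1_gt0 gamma2_gt0 c0_gt0 cvxY cX cY Y0 A1 A2 A3.
have [B rB hB] := lambda_star_bound r gamma2_gt0 cX cY A3.
have [Cd Cd0 hd] := gap_dir_lipschitz r_ge0 gamma1_gt0 gamma2_gt0 cX cY A2 A3 rB.
have [Lt Lt0 ht] := theta_star_lipschitz r_ge0 gamma1_gt0 cvxY cX cY A2 A3 Y0.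
exists L, Cd, Lt; split=> // c eta alpha x y z theta lambda x' y' z' theta'.
move=> c0c a0 eta0 etaL Xx Yy bz Yt; rewrite dir_thetaE pot_dirE => pt pl pw D E.
have cpos : 0 < c by exact: lt_le_trans c0c.
have Yt' := pt.1; have [Xx' Yy' bz'] := row3_XYZ pw.1.
have Ys := theta_star_in gamma1 cY A2 A3 Y0 y z Xx.
have Dw := XYZ_row3 Xx Yy bz; have Dw' := pw.1.
have lE := lambda_star_unique pl; rewrite lE in pw.
set d := pot_dir c x y z theta' (lambda_star x y z) in pw.
have gd : enorm (grad_pot c (row3 x y z) - d) <= Cd * E.
  have := hd _ _ _ _ _ z _ _ _ (lambda_star x y z) Xx Xx Yy Yy bz Ys Yt'
    (fun i => hB _ _ _ i Xx Yy bz).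
  rewrite subrr enorm0 add0r subrr enorm0 addr0 (enormB (theta_star x y z)) -/E.
  rewrite /grad_pot /d /pot_dir.
  have -> : lsubmx (lsubmx (row3 x y z)) = x by rewrite /row3 !row_mxKl.
  have -> : rsubmx (lsubmx (row3 x y z)) = y by rewrite /row3 row_mxKl row_mxKr.
  have -> : rsubmx (row3 x y z) = z by rewrite /row3 row_mxKr.
  by rewrite opprD addrACA subrr add0r.
have cD := @cvx_XYZ R n m p X Y r cvxX cvxY.
split.
- have := proj_step_descent cD (fun w v Dw =>
    is_derive_pot r_ge0 gamma1_gt0 gamma2_gt0 cvxY cY Y0 A1 A2 A3 v Dw cpos)
    (hL _ c0c) a0 Dw pw.
  move/le_trans; apply; rewrite lerD2l; apply: ler_wpM2r gd; exact: enorm_ge0.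
- exact: (theta_step_contraction r_ge0 gamma1_gt0 cvxY cY A2 A3 Y0 Xx bz Yt eta0 etaL pt).
- apply: le_trans (enormBD (theta_star x y z) _ _) _; rewrite lerD2l.
  by rewrite /D enormB; exact: ht.
have vi u : XYZ u -> dot (row3 x y z - alpha *: d - row3 x' y' z') (u - row3 x' y' z') <= 0.
  by move=> Du; exact: (proj_vi cD pw Du).
set w := row3 x y z in Dw gd pw vi D *; set w' := row3 x' y' z' in Dw' pw vi D *.
rewrite /residual /dist0; set S := [set enorm v | v in _].
(* The projection inequality puts [w - alpha d - w'] in the normal cone at [w']; the factor matches
   the gradient [c * grad_pot] and the step [alpha]. *)
pose v0 := (c / alpha) *: (w - alpha *: d - w').
have S0 : S (enorm (grad_psi Y F f g gamma1 gamma2 c w' + v0)).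
  exists (grad_psi Y F f g gamma1 gamma2 c w' + v0) => //; exists v0 => //.
  split=> // u Du; rewrite /v0 dotZl mulr_ge0_le0//; last exact: vi.
  by rewrite divr_ge0// ltW.
have lbS : lbound S 0 by move=> _ [v _ <-]; exact: enorm_ge0.
apply/andP; split.
  apply: lb_le_inf lbS.
  by exists (enorm (grad_psi Y F f g gamma1 gamma2 c w' + v0)).
apply: le_trans (_ : enorm (grad_psi Y F f g gamma1 gamma2 c w' + v0) <= _).
  by apply: ge_inf S0; exists 0.
rewrite (grad_psi_pot r_ge0 gamma1_gt0 gamma2_gt0 cvxY cY Y0 A1 A2 A3 Dw' cpos).
(* Three errors: the gradient's variation over the step, the inexact direction, and the step divided
   by [alpha]. *)
have vec (G' G u u' e : 'rV[R]_(n + m + p)) :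
    c *: G' + (c / alpha) *: (u - alpha *: e - u') =
    c *: ((G' - G) + (G - e) + alpha^-1 *: (u - u')).
  by apply/rowP => i; rewrite !mxE; field; rewrite gt_eqF.
rewrite /v0 (vec _ (grad_pot c w)).
rewrite enormZ gtr0_norm// ler_pM2l//.
apply: le_trans (enormD _ _) _; apply: le_trans (lerD (enormD _ _) (lexx _)) _.
rewrite enormZ gtr0_norm ?invr_gt0// (enormB w) -/D.
rewrite mulrDl [leRHS]addrAC.
exact: lerD (lerD (hL _ c0c _ _ Dw' Dw) gd) (lexx _).
Qed.

End Iteration.

Theorem theorem4p5 (R : realType) (n m p : nat)
  (X : set 'rV[R]_n) (Y : set 'rV[R]_m) (r : R)
  (F f : 'rV[R]_(n + m) -> R) (g : 'rV[R]_(n + m) -> 'rV[R]_p)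
  (LF Lf Lg Lg1 Lg2 gamma1 gamma2 c0 rho eta_low : R) (c eta : nat -> R) :
  closed X -> convex_set X -> closed Y -> convex_set Y -> 0 <= r ->
  assumptionA1 X Y F LF ->
  assumptionA2 X Y f Lf ->
  assumptionA3 X Y g Lg Lg1 Lg2 ->
  compact X -> compact Y ->
  0 < gamma1 -> 0 < gamma2 ->
  0 < c0 -> 0 <= rho < 1 / 2 ->
  (forall k, c k = c0 * (k.+1%:R `^ rho)) ->
  0 < eta_low ->
  (forall k, eta_low < eta k < 1 / (Lf + r * Lg2 + 1 / gamma1)) ->
  exists2 c_alpha : R, 0 < c_alpha &
    forall (alpha_low : R) (alpha : nat -> R),
    0 < alpha_low ->
    (forall k, alpha_low < alpha k < c_alpha) ->
    forall (x : nat -> 'rV[R]_n) (y : nat -> 'rV[R]_m) (z : nat -> 'rV[R]_p)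
      (theta : nat -> 'rV[R]_m) (lambda : nat -> 'rV[R]_p),
    BiC_GAFFA X Y r F f g gamma1 gamma2 c eta alpha x y z theta lambda ->
    let Rk k := residual X Y r F f g gamma1 gamma2 (c k)
                  (x k.+1) (y k.+1) (z k.+1) in
    ((fun K : nat => \big[Num.min/Rk 0%N]_(k < K.+1) Rk k) : nat -> R)
      =O_\oo (fun K : nat => 1 / (K%:R `^ ((1 - 2 * rho) / 2)))
    /\
    (0 < rho ->
     (exists M : R, forall k,
        psi Y F f g gamma1 gamma2 (c k) (x k) (y k) (z k) <= M) ->
     (forall K, 0 <= gap Y f g gamma1 gamma2 (x K) (y K) (z K)) /\
     ((fun K : nat => gap Y f g gamma1 gamma2 (x K) (y K) (z K)) : nat -> R)
       =O_\oo (fun K : nat => 1 / (K%:R `^ rho))).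
Proof.
move=> clX cvX clY cvY r0 A1 A2 A3 cX cY g1 g2 c00 rho01 cE el0 etaE.
have [Y0|Ye] := pselect (Y !=set0); last first.
  (* With [Y] empty there is no run, so any value will do. *)
  exists 1 => // al alpha _ _ x y z theta lambda alg.
  by case: Ye; exists (y 0%N); have [] := gaffa_init alg.
have cvxX := convex_set_cvx cvX; have cvxY := convex_set_cvx cvY.
have [L [Cd [Lt [[L0 Cd0 Lt0] step]]]] :=
  iteration_bounds r0 g1 g2 c00 cvxX cvxY cX cY Y0 A1 A2 A3.
have [_ _ _ [Fl hFl]] := A1; have [Lf0 _ _ _] := A2; have [[_ _ Lg20] _ _ _ _] := A3.
have /andP[rho0 _] := rho01.
have ck0 k : c0 <= c k.
  rewrite cE ler_peMr ?(ltW c00)// -[leLHS](powRr0 k.+1%:R).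
  by rewrite ler_powR// ler1n.
have cpos k : 0 < c k by exact: lt_le_trans (ck0 k).
have cmono k : c k <= c k.+1.
  rewrite !cE ler_wpM2l ?(ltW c00)//.
  by apply: ge0_ler_powR; rewrite ?nnegrE// ler_nat.
(* As [eta_low < eta k], every contraction factor is at most [1 - kappa]. *)
pose kappa := eta_low / gamma1; have kappa0 : 0 < kappa by exact: divr_gt0.
pose Ce := (Cd ^+ 2 + 2) / kappa.
have Ce0 : 0 <= Ce by rewrite divr_ge0 ?(ltW kappa0)// addr_ge0// sqr_ge0.
pose A0 := L / 2 + 3 / 2 + Ce * (1 + 2 / kappa) * Lt ^+ 2.
have A00 : 0 < A0.
  rewrite /A0 ltr_pwDl//; first by lra.
  rewrite mulr_ge0 ?sqr_ge0// mulr_ge0// addr_ge0// divr_ge0// ltW//.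
(* [alpha k < 1 / A0] yields the threshold of [lyapunov_step] for [1 / alpha k]; [A0] is independent
   of [alpha_low]. *)
exists A0^-1; first by rewrite invr_gt0.
move=> al alpha al0 alphaE x y z theta lambda alg /=.
have inX k : [/\ X (x k), Y (y k), box p r (z k) & Y (theta k)].
  case: k => [|k]; first exact: gaffa_init alg.
  have [] := row3_XYZ (gaffa_xyz alg k).1.
  by move=> ? ? ?; split => //; exact: (gaffa_theta alg k).1.
pose ts k := theta_star Y f g gamma1 (x k) (y k) (z k).
pose D k := enorm (row3 (x k.+1) (y k.+1) (z k.+1) - row3 (x k) (y k) (z k)).
pose E k := enorm (theta k.+1 - ts k); pose e k := enorm (theta k - ts k).
(* Penalty index and iterate index are separate: a step lowers [ph k] from iterate [k] to [k + 1],
   and only then does the penalty change. *)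
pose ph k l := pot Y F f g gamma1 gamma2 (c k) (row3 (x l) (y l) (z l)).
have alpha0 k : 0 < alpha k by have /andP[h _] := alphaE k; exact: lt_trans h.
have alphaV k : A0 <= (alpha k)^-1.
  have /andP[_ h] := alphaE k; rewrite -[A0]invrK lef_pV2 ?posrE ?invr_gt0//.
  exact: ltW.
have steps k : [/\ ph k k.+1 <= ph k k - ((alpha k)^-1 - L / 2) * D k ^+ 2
      + Cd * E k * D k,
    E k ^+ 2 <= (1 - kappa) * e k ^+ 2,
    e k.+1 <= E k + Lt * D k
  & 0 <= residual X Y r F f g gamma1 gamma2 (c k) (x k.+1) (y k.+1) (z k.+1)
      <= c k * ((L + (alpha k)^-1) * D k + Cd * E k)].
  have [Xx Yy bz Yt] := inX k; have /andP[e1 e2] := etaE k.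
  have eta0 : 0 < eta k by exact: lt_trans e1.
  have etaL : eta k * (Lf + r * Lg2 + gamma1^-1) <= 1.
    have P0 : 0 < Lf + r * Lg2 + gamma1^-1.
      by rewrite ltr_wpDl ?invr_gt0// addr_ge0// mulr_ge0.
    by move: e2; rewrite !mul1r => /ltW; rewrite -ler_pdivlMr// mul1r.
  have [h1 h2 h3 h4] := step _ _ _ _ _ _ _ _ _ _ _ _ (ck0 k) (alpha0 k) eta0 etaL
    Xx Yy bz Yt (gaffa_theta alg k) (gaffa_lambda alg k) (gaffa_xyz alg k).
  split => //; apply: le_trans h2 _; apply: ler_wpM2r; first exact: sqr_ge0.
  by rewrite lerD2l lerN2 ler_pM2r ?invr_gt0// ltW.
have Ele k : E k <= e k.
  have [_ h _ _] := steps k; rewrite -(@ler_pXn2r _ 2)// ?nnegrE ?enorm_ge0//.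
  have := mulr_ge0 (ltW kappa0) (sqr_ge0 (e k)); lra.
have FFl k : Fl <= F (row_mx (x k) (y k)).
  apply: hFl; exists (row_mx (x k) (y k)) => //.
  by have [? ? _ _] := inX k; exact: row_mx_setprod.
have gap0 k : 0 <= gap Y f g gamma1 gamma2 (x k) (y k) (z k).
  by have [? ? ? _] := inX k; exact: (gap_ge0 gamma1 g2 cY Y0 A2 A3).
pose V k := ph k k - (c k)^-1 * Fl + Ce * e k ^+ 2.
have VE k l : ph l k - (c l)^-1 * Fl =
    (c l)^-1 * (F (row_mx (x k) (y k)) - Fl) + gap Y f g gamma1 gamma2 (x k) (y k) (z k).
  by rewrite /ph pot_row3//; ring.
have V0 k : 0 <= V k.
  rewrite /V VE; apply: addr_ge0; last by apply: mulr_ge0 (sqr_ge0 _).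
  apply: addr_ge0 (gap0 k); apply: mulr_ge0; first by rewrite invr_ge0 ltW.
  by rewrite subr_ge0.
have VS k : V k.+1 + (D k ^+ 2 + e k ^+ 2) <= V k.
  have [h1 h2 h3 _] := steps k.
  have D0 : 0 <= D k by exact: enorm_ge0.
  have E0 : 0 <= E k by exact: enorm_ge0.
  have e0 : 0 <= e k.+1 by exact: enorm_ge0.
  have s : ph k k.+1 + Ce * e k.+1 ^+ 2 + (D k ^+ 2 + e k ^+ 2) <=
      ph k k + Ce * e k ^+ 2.
    exact: (lyapunov_step D0 E0 e0 Lt0 kappa0 h1 h2 h3 (alphaV k)).
  (* Change of penalty at a fixed iterate: [F - Fl >= 0] and [1 / c] does not increase. *)
  have h : ph k.+1 k.+1 - (c k.+1)^-1 * Fl <= ph k k.+1 - (c k)^-1 * Fl.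
    rewrite !VE lerD2r; apply: ler_wpM2r; first by rewrite subr_ge0.
    by rewrite lef_pV2 ?posrE.
  rewrite /V; clear -h s; clearbody ph D e Ce.
  move: h s; move: (ph k.+1 k.+1) (ph k k.+1) (ph k k) => p1 p2 p3.
  by move: ((c k)^-1 * Fl) ((c k.+1)^-1 * Fl) => *; lra.
have al0V : 0 <= al^-1 by rewrite invr_ge0 ltW.
have CR0 : 0 <= L + al^-1 + Cd by apply: addr_ge0 Cd0; exact: addr_ge0.
have D0 k : 0 <= D k by exact: enorm_ge0.
have e0 k : 0 <= e k by exact: enorm_ge0.
have Rk0 k : 0 <= residual X Y r F f g gamma1 gamma2 (c k) (x k.+1) (y k.+1) (z k.+1).
  by have [_ _ _ /andP[]] := steps k.
have Rk1 k : residual X Y r F f g gamma1 gamma2 (c k) (x k.+1) (y k.+1) (z k.+1) <=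
    c k * ((L + al^-1 + Cd) * (D k + e k)).
  have [_ _ _ /andP[_ h]] := steps k.
  apply: le_trans h _; apply: ler_wpM2l; first exact: ltW.
  have /andP[a1 _] := alphaE k.
  (* The lower stepsize bound keeps the constant of the residual estimate uniform in [k]. *)
  have aV : (alpha k)^-1 <= al^-1 by rewrite lef_pV2 ?posrE// ltW.
  have k1 := ler_wpM2r (D0 k) aV; have k2 := ler_wpM2l Cd0 (Ele k).
  have k3 := mulr_ge0 Cd0 (D0 k); have k4 := mulr_ge0 (addr_ge0 L0 al0V) (e0 k).
  clear -k1 k2 k3 k4; clearbody D E e.
  move: k1 k2 k3 k4; move: (al^-1) ((alpha k)^-1) => *; lra.
split.
  exact: (min_rate c00 rho01 CR0 cE D0 e0 Rk0 Rk1 (sum_le_of_descent V0 VS)).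
move=> rho_gt0 [M hM]; split => //.
apply: (@gap_rate R c0 rho (M - Fl) c) => // k.
by have := hM k; have := FFl k; rewrite /psi; lra.
Qed.
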